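(* Let $\mathrm{k}$ be a field, let $G$ be a simple graph without isolated vertices with vertex set $V(G)=[n]=\{1,\ldots,n\}$, and let $S=\mathrm{k}[x_1,\ldots,x_n]$. Let $J(G)=\bigcap_{\{i,j\}\in E(G)}(x_i,x_j)\subseteq S$ be the cover ideal of $G$. Then, for every integer $t\ge 1$, $$\operatorname{depth}\left(S/J(G)^{(t)}\right)\le n-1-\alpha_t(G),$$ where $J(G)^{(t)}$ is the $t$-th symbolic power of $J(G)$ and $\alpha_t(G)$ is the maximum size of an ordered matching $M$ of $G$ with $\ell(M)\le 2t-1$. Moreover, equality holds whenever $G$ is a forest.
   Context: $G$ has vertex set $V(G)$ and edge set $E(G)$. A forest is a graph with no cycles. A matching of $G$ is a subset $M\subseteq E(G)$ such that no two edges of $M$ share a common vertex. A matching $M=\{\{u_1,v_1\},\ldots,\{u_r,v_r\}\}$ is called an ordered matching of $G$ if (1) $\{u_1,\ldots,u_r\}$ is an independent set of $G$ (no two of its vertices are adjacent in $G$), and (2) $\{u_i,v_j\}\in E(G)$ implies $i\le j$. For a matching $M$ of $G$, an $M$-alternating path is a path in $G$ whose edges alternately belong to $M$ and to $E(G)\setminus M$. Such a path need not be simple; its length is the number of edges that it traverses. $\ell(M)$ denotes the maximum length of an $M$-alternating path in $G$. For each integer $t\ge1$, $$\alpha_t(G)=\max\{|M| : M \text{ is an ordered matching of } G \text{ and } \ell(M)\le 2t-1\}.$$ The $t$-th symbolic power of $J(G)$ is $J(G)^{(t)}=\bigcap_{\{i,j\}\in E(G)}(x_i,x_j)^t$. The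 depth of a nonzero finitely generated graded $S$-module $N$ is the least $i$ such that the local cohomology module $H^i_{\mathfrak m}(N)$ is nonzero, where $\mathfrak m=(x_1,\ldots,x_n)$.
   Formalization: M-alternating paths are required to start and end with an edge of M; without this the equality for forests fails, e.g. for the path 1-2-3 and t=1 (α_1 would be 0, giving depth 2, but the depth is 1). *)

(* Defs.v *)
From HB Require Import structures.
From mathcomp Require Import all_boot all_order all_algebra.
From mathcomp Require Import generic_quotient ring_quotient boolp mpoly.
From mathcomp Require Import zify ring.

Set Implicit Arguments.
Unset Strict Implicit.
Unset Printing Implicit Defensive.

Import GRing.Theory.
Local Open Scope ring_scope.
Local Open Scope quotient_scope.

Section QuotMod.
Variables (R : nzRingType) (V : lmodType R) (W : submodClosed V).

Definition submod_pred : V -> bool := fun v => v \in W.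

Fact submod_pred_closed : zmod_closed submod_pred.
Proof. exact: GRing.submod_closedB (submodClosedP W). Qed.

HB.instance Definition _ := GRing.isZmodClosed.Build V submod_pred
  submod_pred_closed.

Definition submod_zmod : zmodClosed V := GRing.ZmodClosed.clone V submod_pred _.

Definition quotmod := Quotient.quot submod_zmod.

HB.instance Definition _ := GRing.Zmodule.on quotmod.

Definition quotmod_proj (v : V) : quotmod := \pi_(Quotient.quot submod_zmod) v.

Lemma quotmod_projP (v w : V) :
  reflect (quotmod_proj v = quotmod_proj w) (v - w \in W).
Proof. by rewrite (Quotient.idealrBE submod_zmod); apply: eqP. Qed.

Lemma quotmod_surj (x : quotmod) : exists v, x = quotmod_proj v.
Proof. by exists (repr x); rewrite /quotmod_proj reprK. Qed.

Lemma quotmod_projD : {morph quotmod_proj : v w / v + w}.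
Proof. by move=> v w; rewrite /quotmod_proj [LHS]raddfD. Qed.

Definition quotmod_scale (a : R) (x : quotmod) : quotmod :=
  quotmod_proj (a *: repr x).

Lemma quotmod_scaleE a v :
  quotmod_scale a (quotmod_proj v) = quotmod_proj (a *: v).
Proof.
apply/quotmod_projP; rewrite -scalerBr rpredZ //.
by rewrite (Quotient.idealrBE submod_zmod) reprK.
Qed.

Fact quotmod_scaleA a b (x : quotmod) :
  quotmod_scale a (quotmod_scale b x) = quotmod_scale (a * b) x.
Proof. by have [v ->] := quotmod_surj x; rewrite !quotmod_scaleE scalerA. Qed.

Fact quotmod_scale1 : left_id 1 quotmod_scale.
Proof. by move=> x; have [v ->] := quotmod_surj x; rewrite quotmod_scaleE scale1r. Qed.

Fact quotmod_scaleDr : right_distributive quotmod_scale +%R.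
Proof.
move=> a x y; have [v ->] := quotmod_surj x; have [w ->] := quotmod_surj y.
by rewrite -quotmod_projD !quotmod_scaleE scalerDr quotmod_projD.
Qed.

Fact quotmod_scaleDl (x : quotmod) : {morph quotmod_scale^~ x : a b / a + b}.
Proof.
move=> a b; have [v ->] := quotmod_surj x.
by rewrite !quotmod_scaleE scalerDl quotmod_projD.
Qed.

HB.instance Definition _ := GRing.Zmodule_isLmodule.Build R quotmod
  quotmod_scaleA quotmod_scale1 quotmod_scaleDr quotmod_scaleDl.

Lemma quotmod_projZ a v : quotmod_proj (a *: v) = a *: quotmod_proj v.
Proof. by rewrite -quotmod_scaleE. Qed.

End QuotMod.

(* [localization N f] is N_f; [Frac f a k] is its fraction a / f^k. *)

Section Localization.
Variables (R : comNzRingType) (N : lmodType R) (f : R).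

Definition frac_equiv (u v : N * nat) : bool :=
  `[< exists m, f ^+ m *: (f ^+ v.2 *: u.1 - f ^+ u.2 *: v.1) = 0 >].

Lemma frac_equivP u v : reflect
  (exists m, f ^+ m *: (f ^+ v.2 *: u.1) = f ^+ m *: (f ^+ u.2 *: v.1))
  (frac_equiv u v).
Proof.
apply: (iffP (asboolP _)) => -[m] E; exists m.
  by apply/eqP; rewrite -subr_eq0 -scalerBr E.
by rewrite scalerBr E subrr.
Qed.

Fact frac_equiv_is_equiv : equiv_class_of frac_equiv.
Proof.
split=> [u|u v|v u w].
- by apply/frac_equivP; exists 0%N.
- by apply/frac_equivP/frac_equivP => -[m E]; exists m.
move: u v w => [a k] [b l] [c q].
move=> /frac_equivP[m /= E] /frac_equivP[p /= F]; apply/frac_equivP.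
exists (m + p + l)%N; rewrite !scalerA -!exprD /= in E F *.
transitivity (f ^+ (p + q) *: (f ^+ (m + l) *: a)).
  by rewrite scalerA -exprD; congr (f ^+ _ *: _); lia.
rewrite E.
transitivity (f ^+ (m + k) *: (f ^+ (p + q) *: b)).
  by rewrite !scalerA -!exprD addnC.
by rewrite F scalerA -exprD; congr (f ^+ _ *: _); lia.
Qed.

Canonical frac_equiv_equiv := EquivRelPack frac_equiv_is_equiv.
Canonical frac_equiv_encModRel := defaultEncModRel frac_equiv.

Definition localization := {eq_quot frac_equiv}.
HB.instance Definition _ := Choice.on localization.
HB.instance Definition _ := EqQuotient.on localization.

Definition Frac (a : N) (k : nat) : localization := \pi_localization (a, k).

Lemma Frac_eqP a k b l : Frac a k = Frac b l <->
  exists m, f ^+ m *: (f ^+ l *: a) = f ^+ m *: (f ^+ k *: b).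
Proof.
by split=> [/eqmodP/frac_equivP //|E]; apply/eqmodP/frac_equivP.
Qed.

Definition num_exp (u : localization) : N * nat := repr u.

Lemma Frac_num_exp u : Frac (num_exp u).1 (num_exp u).2 = u.
Proof. by rewrite /Frac -surjective_pairing reprK. Qed.

Lemma FracP u : exists a k, u = Frac a k.
Proof. by exists (num_exp u).1, (num_exp u).2; rewrite Frac_num_exp. Qed.

Lemma num_exp_Frac a k : exists m, f ^+ m *: (f ^+ k *: (num_exp (Frac a k)).1)
  = f ^+ m *: (f ^+ (num_exp (Frac a k)).2 *: a).
Proof. by apply/Frac_eqP; rewrite Frac_num_exp. Qed.

Definition loc_zero : localization := Frac 0 0.

Definition loc_opp (u : localization) : localization :=
  let: (a, k) := num_exp u in Frac (- a) k.

Definition loc_add (u v : localization) : localization :=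
  let: (a, k) := num_exp u in let: (b, l) := num_exp v in
  Frac (f ^+ l *: a + f ^+ k *: b) (k + l).

Definition loc_scale (r : R) (u : localization) : localization :=
  let: (a, k) := num_exp u in Frac (r *: a) k.

Lemma loc_scaleE r a k : loc_scale r (Frac a k) = Frac (r *: a) k.
Proof.
rewrite /loc_scale; have [m] := num_exp_Frac a k.
case: (num_exp (Frac a k)) => a' k' /= E.
have sw (c : R) b : r *: (c *: b) = c *: (r *: b) by rewrite !scalerA mulrC.
by apply/Frac_eqP; exists m; rewrite -!sw E.
Qed.

Lemma loc_oppE a k : loc_opp (Frac a k) = Frac (- a) k.
Proof.
rewrite -[- a]scaleN1r -loc_scaleE /loc_opp /loc_scale.
by case: (num_exp _) => b l; rewrite scaleN1r.
Qed.

Lemma loc_addE a k b l :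
  loc_add (Frac a k) (Frac b l) = Frac (f ^+ l *: a + f ^+ k *: b) (k + l).
Proof.
rewrite /loc_add; have [m] := num_exp_Frac a k; have [p] := num_exp_Frac b l.
case: (num_exp (Frac a k)) (num_exp (Frac b l)) => [a' k'] [b' l'] /=.
rewrite !scalerA -!exprD => F E; apply/Frac_eqP; exists (m + p)%N.
rewrite !scalerDr !scalerA -!exprD; congr (_ + _).
  transitivity (f ^+ (p + l + l') *: (f ^+ (m + k) *: a')).
    by rewrite scalerA -exprD; congr (f ^+ _ *: _); lia.
  by rewrite E scalerA -exprD; congr (f ^+ _ *: _); lia.
transitivity (f ^+ (m + k + k') *: (f ^+ (p + l) *: b')).
  by rewrite scalerA -exprD; congr (f ^+ _ *: _); lia.
by rewrite F scalerA -exprD; congr (f ^+ _ *: _); lia.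
Qed.

Lemma Frac_cancel a k p : Frac (f ^+ p *: a) (p + k) = Frac a k.
Proof. by apply/Frac_eqP; exists 0%N; rewrite !scalerA -!exprD addnC. Qed.

Lemma loc_addE_same a b k : loc_add (Frac a k) (Frac b k) = Frac (a + b) k.
Proof. by rewrite loc_addE -scalerDr Frac_cancel. Qed.

Fact loc_addA : associative loc_add.
Proof.
move=> u v w; have [a [k ->]] := FracP u; have [b [l ->]] := FracP v.
have [c [q ->]] := FracP w; rewrite !loc_addE !scalerDr !scalerA -!exprD.
by rewrite !addrA !addnA; congr (Frac (_ *: _ + _ *: _ + _ *: _) _);
  congr (f ^+ _); lia.
Qed.

Fact loc_addC : commutative loc_add.
Proof.
move=> u v; have [a [k ->]] := FracP u; have [b [l ->]] := FracP v.
by rewrite !loc_addE addrC addnC.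
Qed.

Fact loc_add0 : left_id loc_zero loc_add.
Proof.
by move=> u; have [a [k ->]] := FracP u; rewrite loc_addE scaler0 add0r scale1r.
Qed.

Fact loc_addN : left_inverse loc_zero loc_opp loc_add.
Proof.
move=> u; have [a [k ->]] := FracP u; rewrite loc_oppE loc_addE_same addNr.
by apply/Frac_eqP; exists 0%N; rewrite !scaler0.
Qed.

HB.instance Definition _ := GRing.isZmodule.Build localization
  loc_addA loc_addC loc_add0 loc_addN.

Fact loc_scaleA r s u : loc_scale r (loc_scale s u) = loc_scale (r * s) u.
Proof. by have [a [k ->]] := FracP u; rewrite !loc_scaleE scalerA. Qed.

Fact loc_scale1 : left_id 1 loc_scale.
Proof. by move=> u; have [a [k ->]] := FracP u; rewrite loc_scaleE scale1r. Qed.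

Fact loc_scaleDr : right_distributive loc_scale +%R.
Proof.
move=> r u v; have [a [k ->]] := FracP u; have [b [l ->]] := FracP v.
rewrite [Frac a k + _]loc_addE !loc_scaleE [RHS]loc_addE scalerDr !scalerA.
by rewrite ![r * _]mulrC.
Qed.

Fact loc_scaleDl u : {morph loc_scale^~ u : r s / r + s}.
Proof.
move=> r s; have [a [k ->]] := FracP u.
by rewrite !loc_scaleE [RHS]loc_addE_same scalerDl.
Qed.

HB.instance Definition _ := GRing.Zmodule_isLmodule.Build R localization
  loc_scaleA loc_scale1 loc_scaleDr loc_scaleDl.

Lemma FracD a b k : Frac (a + b) k = Frac a k + Frac b k.
Proof. by rewrite [RHS]loc_addE_same. Qed.

Lemma FracZ r a k : Frac (r *: a) k = r *: Frac a k.
Proof. by rewrite -loc_scaleE. Qed.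

Lemma Frac_eq0 a k : Frac a k = 0 <-> exists m, f ^+ m *: a = 0.
Proof.
split=> [/Frac_eqP[m]|[m E]].
  by rewrite !scaler0 scale1r => E; exists m.
by apply/Frac_eqP; exists m; rewrite !scaler0 scale1r.
Qed.

End Localization.

(* For [h = f * g], the localization map N_f -> N_h, a / f^k |-> g^k a / h^k *)
Definition loc_map (R : comNzRingType) (N : lmodType R) (f g h : R)
    (u : localization N f) : localization N h :=
  Frac h (g ^+ (num_exp u).2 *: (num_exp u).1) (num_exp u).2.

Lemma loc_mapE (R : comNzRingType) (N : lmodType R) (f g h : R) (a : N) k :
  h = f * g -> loc_map g h (Frac f a k) = Frac h (g ^+ k *: a) k.
Proof.
move=> ->; have [m] := num_exp_Frac f a k; rewrite /loc_map.
case: (num_exp _) => a' k' /= E; apply/Frac_eqP; exists m.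
transitivity (g ^+ (m + k + k') *: (f ^+ m *: (f ^+ k *: a'))).
  by rewrite !scalerA !exprMn !exprD; congr (_ *: _); ring.
by rewrite E !scalerA !exprMn !exprD; congr (_ *: _); ring.
Qed.

(* Local cohomology with support in the ideal (x_0, ..., x_{n-1}), as the
   cohomology of the Cech complex
     0 -> N -> (+)_i N_{x_i} -> (+)_{i<j} N_{x_i x_j} -> ... -> N_{x_0...x_{n-1}} -> 0.
   A p-cochain is a family indexed by the subsets F of size p; a [cochain]
   below packs all degrees together, and only its components of the relevant
   size are looked at. *)

Section LocalCohomology.
Variables (R : comNzRingType) (n : nat) (x : 'I_n -> R) (N : lmodType R).
Implicit Types (F : {set 'I_n}) (p : nat).

Definition xprod F : R := \prod_(i in F) x i.

Definition cochain := forall F, localization N (xprod F).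

Definition cech_diff (c : cochain) : cochain := fun F =>
  \sum_(j in F) (-1) ^+ #|[set l in F | (l < j)%N]| *:
    loc_map (x j) (xprod F) (c (F :\ j)).

Lemma xprodD1 F j : j \in F -> xprod F = xprod (F :\ j) * x j.
Proof. by move=> Fj; rewrite /xprod (big_setD1 j) //= mulrC. Qed.

Definition is_cocycle p (c : cochain) : Prop :=
  forall F, #|F| = p.+1 -> cech_diff c F = 0.

(* For p = 0 the sum defining [cech_diff b set0] is empty, in accordance with
   the Cech complex being zero in degree -1. *)
Definition is_coboundary p (c : cochain) : Prop :=
  exists b : cochain, forall F, #|F| = p -> c F = cech_diff b F.

Definition local_cohomology_neq0 p : Prop :=
  exists c : cochain, is_cocycle p c /\ ~ is_coboundary p c.

Definition is_depth d : Prop :=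
  local_cohomology_neq0 d /\ forall p, (p < d)%N -> ~ local_cohomology_neq0 p.

End LocalCohomology.

Section Ideals.
Variable R : comNzRingType.

Definition gen_ideal (A : R -> Prop) (r : R) : Prop :=
  exists m (c g : 'I_m -> R),
    (forall l, A (g l)) /\ r = \sum_(l < m) c l * g l.

Definition ideal_exp (I : R -> Prop) (t : nat) : R -> Prop :=
  gen_ideal (fun r => exists g : 'I_t -> R,
    (forall l, I (g l)) /\ r = \prod_(l < t) g l).

Lemma gen_ideal0 A : gen_ideal A 0.
Proof.
by exists 0%N, (fun=> 0), (fun=> 0); split=> [[]//|]; rewrite big_ord0.
Qed.

Lemma gen_idealZD A a r s :
  gen_ideal A r -> gen_ideal A s -> gen_ideal A (a * r + s).
Proof.
move=> [m [c [g [Ag ->]]]] [p [d [h [Ah ->]]]].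
pose glue (u : 'I_m -> R) (v : 'I_p -> R) (l : 'I_(m + p)) :=
  match split l with inl i => u i | inr j => v j end.
exists (m + p)%N, (glue (fun i => a * c i) d), (glue g h); split=> [l|].
  by rewrite /glue; case: split.
rewrite big_split_ord /= mulr_sumr; congr (_ + _); apply: eq_bigr => i _.
  by rewrite /glue (unsplitK (inl _ i)) mulrA.
by rewrite /glue (unsplitK (inr _ i)).
Qed.

End Ideals.

(* A graph on [n] is an adjacency relation [e : rel 'I_n], assumed symmetric
   and irreflexive. *)

Section Graph.
Variables (n : nat) (e : rel 'I_n).
Implicit Types (M : {set {set 'I_n}}) (t : nat).

Definition edges : {set {set 'I_n}} :=
  [set [set uv.1; uv.2] | uv in [pred uv : 'I_n * 'I_n | e uv.1 uv.2]].

Definition is_forest : Prop :=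
  forall c : seq 'I_n, (2 < size c)%N -> ~ ucycle e c.

Definition is_matching M : bool := (M \subset edges) && trivIset M.

Definition is_ordered_matching M : Prop :=
  is_matching M /\
  exists u v : 'I_#|M| -> 'I_n,
    [/\ M = [set [set u i; v i] | i : 'I_#|M|],
        forall i j, ~~ e (u i) (u j) &
        forall i j, e (u i) (v j) -> (i <= j)%N].

(* [x :: s] is an alternating walk. It starts and ends with an edge of M, so its
   length [size s] is odd. Allowing a walk to start or end with an edge outside
   M would give alpha_1 = 0 for the path on three vertices, for which
   depth (S / J(G)) = 1 = n - 1 - 1. *)
Definition is_alternating M (x : 'I_n) (s : seq 'I_n) : bool :=
  let inM := pairmap (fun y z => [set y; z] \in M) x s in
  [&& path e x s, sorted (fun b c => b != c) inM, head false inM & last false inM].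

(* l(M) <= L; in particular l(M) is finite. *)
Definition ell_le M (L : nat) : Prop :=
  forall x s, is_alternating M x s -> (size s <= L)%N.

Definition alpha t : nat :=
  \max_(M : {set {set 'I_n}} | `[< is_ordered_matching M /\ ell_le M (2 * t - 1) >]) #|M|.

End Graph.

Section CoverIdeal.
Variables (k : fieldType) (n : nat) (e : rel 'I_n) (t : nat).
Local Notation S := {mpoly k[n]}.

Definition edge_prime (i j : 'I_n) : S -> Prop :=
  gen_ideal (fun r => r = 'X_i \/ r = 'X_j).

(* J(G)^(t); the cover ideal J(G) itself is the case t = 1. *)
Definition cover_symbolic_power : {pred S^o} := fun r =>
  `[< forall i j, e i j -> ideal_exp (edge_prime i j) t r >].

Fact cover_symbolic_power_closed : submod_closed cover_symbolic_power.
Proof.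
split=> [|a r s /asboolP Ir /asboolP Is]; apply/asboolP => i j eij.
  exact: gen_ideal0.
by apply: gen_idealZD; [apply: Ir | apply: Is].
Qed.

HB.instance Definition _ := GRing.isSubmodClosed.Build S S^o
  cover_symbolic_power cover_symbolic_power_closed.

Definition cover_quotient : lmodType S := quotmod cover_symbolic_power.

End CoverIdeal.

(* Main.v *)
From HB Require Import structures.
Require Import Defs.
From mathcomp Require Import all_boot all_order all_algebra mpoly.
From mathcomp Require Import boolp zify ring.

(* S/J^(t) is Z^n-graded.  In degree b, with N the set of negative coordinates and
   h the graph on the complement of N formed by the edges ij of G such that
   b_i + b_j < t, the Cech complex has a copy of k for each set F containing N whose
   complement is not independent in h: it computes the homology of the full simplex
   relative to the independence complex Ind(h).

   Upper bound: an ordered matching M with l(M) <= 2t - 1 yields a degree in which h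
   is exactly M, so that Ind(h) is the boundary of a cross-polytope, a sphere of
   dimension |M| - 1.

   Forests: if v is a leaf of h with neighbour w, then Ind(h) is equivalent to the
   suspension of Ind(h - N[w]), so by induction a nonzero homology class in dimension
   q gives an induced matching of size q + 1 in h.  Ordering it by the degrees at one
   side of a bipartition of G makes it an ordered matching of G, and summing degrees
   along an alternating walk bounds its length by 2t - 1. *)

Set Implicit Arguments.
Unset Strict Implicit.
Unset Printing Implicit Defensive.
Import GRing.Theory.
Local Open Scope ring_scope.

(** * Exterior multiplication and contraction on functions of vertex sets *)

Section Koszul.
Variables (R : comNzRingType) (n : nat).
Implicit Types (F : {set 'I_n}) (i j : 'I_n).
Local Notation chain := {ffun {set 'I_n} -> R}.
Implicit Types (f g : chain).

Definition sgn F j : R := (-1) ^+ #|[set l in F | (l < j)%N]|.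

(** Read [f] as the sum of the [f F] e_F in the exterior algebra: [wedge j] multiplies by e_j on the
    left, [contr j] contracts with the dual of e_j, and [diff] multiplies by the sum of all the
    e_j. *)
Definition wedge j f : chain :=
  [ffun F : {set 'I_n} => if j \in F then sgn F j * f (F :\ j) else 0].

Definition contr j f : chain :=
  [ffun F : {set 'I_n} => if j \in F then 0 else sgn F j * f (j |: F)].

Definition diff f : chain := \sum_j wedge j f.

Lemma diffE f F : diff f F = \sum_(j in F) sgn F j * f (F :\ j).
Proof.
rewrite /diff sum_ffunE [RHS]big_mkcond /=; apply: eq_bigr => j _.
by rewrite ffunE.
Qed.

Lemma sgn_sq F j : sgn F j * sgn F j = 1.
Proof. by rewrite -expr2 sqrr_sign. Qed.

Lemma sgnU1 F i j : i \notin F -> sgn (i |: F) j = (-1) ^+ (i < j)%N * sgn F j.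
Proof.
move=> iF; rewrite /sgn -exprD; congr (_ ^+ _).
case: ltnP => ij.
  rewrite (_ : [set l in _ | _] = i |: [set l in F | (l < j)%N]).
    by rewrite cardsU1 !inE (negPf iF).
  by apply/setP=> l; rewrite !inE; case: eqP => [->|]; rewrite ?ij.
rewrite add0n; congr #|pred_of_set _|; apply/setP=> l; rewrite !inE.
by case: eqP => // ->; rewrite ltnNge ij (negPf iF).
Qed.

Lemma sgnU1_id F j : sgn (j |: F) j = sgn F j.
Proof.
have [jF|jF] := boolP (j \in F); first by rewrite (setUidPr _) ?sub1set.
by rewrite sgnU1 // ltnn mul1r.
Qed.

Lemma sgnD1 F i j : i \in F -> sgn (F :\ i) j = (-1) ^+ (i < j)%N * sgn F j.
Proof.
move=> iF; rewrite -{2}(setD1K iF) sgnU1 ?setD11 // mulrA.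
by rewrite -expr2 sqrr_sign mul1r.
Qed.

Lemma sgnD1_id F j : sgn (F :\ j) j = sgn F j.
Proof.
have [jF|jF] := boolP (j \in F); first by rewrite sgnD1 // ltnn mul1r.
by rewrite (setDidPl _) // disjoint_sym disjoints1.
Qed.

Lemma ord_sign i j : i != j -> (-1) ^+ (i < j)%N = - (-1) ^+ (j < i)%N :> R.
Proof.
rewrite -(inj_eq val_inj) /=; case: ltngtP => //= _ _; rewrite ?expr0 ?expr1 //.
by rewrite opprK.
Qed.

Lemma wedge_anti i j f : i != j -> wedge i (wedge j f) = - wedge j (wedge i f).
Proof.
move=> ij; apply/ffunP=> F; rewrite !ffunE !in_setD1 (eq_sym j i) ij /=.
case: ifP => iF; case: ifP => jF; rewrite ?mulr0 ?oppr0 //.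
rewrite !sgnD1 // (ord_sign ij) setDDl setUC -setDDl; ring.
Qed.

Lemma wedge_sq i f : wedge i (wedge i f) = 0.
Proof.
by apply/ffunP=> F; rewrite !ffunE in_setD1 eqxx /= mulr0 if_same.
Qed.

Lemma contr_wedge i j f : i != j -> contr i (wedge j f) = - wedge j (contr i f).
Proof.
move=> ij; apply/ffunP=> F; rewrite !ffunE in_setD1 in_setU1 (eq_sym j i).
rewrite (negPf ij) /=; case: (boolP (i \in F)) => iF; case: ifP => jF; rewrite ?mulr0 ?oppr0 //.
rewrite sgnU1 // sgnD1 // (ord_sign ij).
have -> : (i |: F) :\ j = i |: F :\ j.
  by rewrite setDUl [[set i] :\ j](setDidPl _) // disjoint_sym disjoints1 inE eq_sym.
ring.
Qed.

Lemma contr_wedge_id i f : contr i (wedge i f) + wedge i (contr i f) = f.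
Proof.
apply/ffunP=> F; rewrite !ffunE setU11 setD11; case: ifP => iF.
  by rewrite setD1K // sgnD1_id add0r mulrA sgn_sq mul1r.
by rewrite setU1K ?iF // sgnU1_id addr0 mulrA sgn_sq mul1r.
Qed.

Fact wedge_is_additive i : zmod_morphism (wedge i).
Proof.
move=> f g; apply/ffunP=> F; rewrite !ffunE; case: ifP => _; last by rewrite subr0.
by rewrite mulrBr.
Qed.
HB.instance Definition _ (i : 'I_n) :=
  GRing.isZmodMorphism.Build chain chain (wedge i) (wedge_is_additive i).

Fact contr_is_additive i : zmod_morphism (contr i).
Proof.
move=> f g; apply/ffunP=> F; rewrite !ffunE; case: ifP => _; first by rewrite subr0.
by rewrite mulrBr.
Qed.
HB.instance Definition _ (i : 'I_n) :=
  GRing.isZmodMorphism.Build chain chain (contr i) (contr_is_additive i).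

Fact diff_is_additive : zmod_morphism diff.
Proof.
move=> f g; rewrite /diff -sumrB; apply: eq_bigr => i _; exact: raddfB.
Qed.
HB.instance Definition _ :=
  GRing.isZmodMorphism.Build chain chain diff diff_is_additive.

Lemma diff_wedge i f : diff (wedge i f) = - wedge i (diff f).
Proof.
rewrite /diff raddf_sum -sumrN /=; apply: eq_bigr => j _.
have [->|ji] := eqVneq j i; first by rewrite !wedge_sq oppr0.
exact: wedge_anti.
Qed.

Lemma diff_sq f : diff (diff f) = 0.
Proof.
transitivity (\sum_i \sum_j wedge i (wedge j f)).
  by apply: eq_bigr => i _; rewrite /diff raddf_sum.
(* By anticommutation the terms with [i < j] cancel those with [j < i]; the diagonal ones vanish. *)
have split2 i : \sum_j wedge i (wedge j f) =
    \sum_(j : 'I_n | (i < j)%N) wedge i (wedge j f)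
    - \sum_(j : 'I_n | (j < i)%N) wedge j (wedge i f).
  rewrite (bigID (fun j => i < j)%N) /=; congr (_ + _); rewrite -sumrN.
  rewrite (bigD1 i) ?ltnn //= wedge_sq add0r; apply: eq_big => [j|j].
    by rewrite -leqNgt ltn_neqAle andbC.
  by case/andP=> _ ji; rewrite wedge_anti // eq_sym.
under eq_bigr do rewrite split2.
by rewrite sumrB [X in X - _](exchange_big_dep predT) //= subrr.
Qed.

(** [contr i] anticommutes with [wedge j] for [j != i], and the two terms at [i] add up to [f]; so
    [contr i] is a contracting homotopy of the full complex. *)
Lemma diff_contr i f : diff (contr i f) = f - contr i (diff f).
Proof.
rewrite /diff raddf_sum /= (bigD1 i) //= [X in _ - X](bigD1 i) //=.
have E : f - contr i (wedge i f) = wedge i (contr i f).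
  by apply/eqP; rewrite subr_eq addrC contr_wedge_id.
rewrite opprD addrA E -sumrN; congr (_ + _); apply: eq_bigr => j ji.
by rewrite contr_wedge ?opprK // eq_sym.
Qed.

End Koszul.

(** * Supports of chains *)

Section Supports.
Variables (R : comNzRingType) (n : nat).
Implicit Types (F N : {set 'I_n}) (i j : 'I_n) (f : {ffun {set 'I_n} -> R}).

Lemma wedge_neq0 j f F : wedge j f F != 0 -> j \in F /\ f (F :\ j) != 0.
Proof.
rewrite ffunE; case: ifP => [jF|_]; last by rewrite eqxx.
by move=> nz; split=> //; apply: contraNneq nz => ->; rewrite mulr0.
Qed.

Lemma contr_neq0 j f F : contr j f F != 0 -> j \notin F /\ f (j |: F) != 0.
Proof.
rewrite ffunE; case: ifP => [_|jF]; first by rewrite eqxx.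
by move=> nz; split; rewrite ?jF //; apply: contraNneq nz => ->; rewrite mulr0.
Qed.

Lemma diff_neq0 f F : diff f F != 0 -> exists2 j, j \in F & f (F :\ j) != 0.
Proof.
move=> nz; apply/exists_inP; apply: contraNT nz => /exists_inPn noj.
rewrite diffE big1 // => j jF.
by have /negPn/eqP -> := noj j jF; rewrite mulr0.
Qed.

End Supports.

Lemma pairwise_in (T : eqType) (r : rel T) (L : seq T) : ssrbool.symmetric r ->
  pairwise r L -> {in L &, forall p q, p != q -> r p q}.
Proof.
move=> r_sym; elim: L => // x L IH /= /andP[/allP xL /IH H] p q.
rewrite !inE => /predU1P[->|pL] /predU1P[->|qL]; rewrite ?eqxx //.
- by move=> _; apply: xL.
- by move=> _; rewrite r_sym; apply: xL.
exact: H.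
Qed.

(** * Homology of independence complexes, by induction on leaves *)

Section LeafInduction.
Variables (R : comNzRingType) (n : nat) (h : rel 'I_n).
Hypotheses (h_sym : ssrbool.symmetric h) (h_irr : irreflexive h).
Implicit Types (F N W : {set 'I_n}) (i j : 'I_n) (f g : {ffun {set 'I_n} -> R}).

Definition indep W : bool := [forall x in W, forall y in W, ~~ h x y].

Lemma indepP W : reflect {in W &, forall x y, ~~ h x y} (indep W).
Proof.
apply: (iffP forall_inP) => [H x y xW yW|H x xW].
  exact: (forall_inP (H x xW)).
by apply/forall_inP=> y; apply: H.
Qed.

Lemma indepPn W : reflect (exists x y, [/\ x \in W, y \in W & h x y]) (~~ indep W).
Proof.
apply: (iffP forall_inPn) => [[x xW]|[x [y [xW yW hxy]]]].
  by case/forall_inPn=> y yW /negPn hxy; exists x, y.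
by exists x => //; apply/forall_inPn; exists y => //; rewrite hxy.
Qed.

Definition far x y : bool := (x != y) && ~~ h x y.

Definition sep (p q : 'I_n * 'I_n) : bool :=
  [&& far p.1 q.1, far p.1 q.2, far p.2 q.1 & far p.2 q.2].

Lemma sep_sym : ssrbool.symmetric sep.
Proof.
have fs x y : far x y = far y x by rewrite /far eq_sym h_sym.
move=> p q; rewrite /sep ![far _ q.1]fs ![far _ q.2]fs.
by congr (_ && _); rewrite andbCA.
Qed.

Definition induced_matching N (L : seq ('I_n * 'I_n)) : bool :=
  all (fun p => [&& p.1 \notin N, p.2 \notin N & h p.1 p.2]) L && pairwise sep L.

(** The form in which acyclicity enters the inductions: every induced subgraph with an edge has a
    vertex of degree one. *)
Definition leafy : Prop := forall N,
  (exists x y, [/\ x \notin N, y \notin N & h x y]) ->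
  exists v w, [/\ v \notin N, w \notin N, h v w & forall z, z \notin N -> h v z -> z = w].

(** Via the complement of [F], such an [f] is a simplicial chain on the independence complex of h -
    N; [diff], which enlarges [F], is its boundary map. *)
Definition ind_supp N f : Prop :=
  forall F, f F != 0 -> N \subset F /\ indep (~: F).

Lemma subset_contr N F v : v \notin N -> N \subset v |: F -> N \subset F.
Proof.
move=> vN /subsetP NF; apply/subsetP=> x xN; have := NF x xN.
by rewrite in_setU1 => /predU1P[xv|//]; rewrite -xv xN in vN.
Qed.

(** Deleting [v] from [F] adds it to the face, so [contr v] forms the cone with apex [v]. *)
Lemma ind_supp_cone N f v : v \notin N ->
  (forall F, f F != 0 -> N \subset F /\ indep (v |: ~: F)) -> ind_supp N (contr v f).
Proof.
move=> vN fN F /contr_neq0[vF /fN[NF iF]]; split; first exact: subset_contr NF.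
suff -> : ~: F = v |: ~: (v |: F) by [].
by apply/setP=> x; rewrite !inE negb_or; case: eqP => // ->; rewrite vF.
Qed.

Hypothesis h_leafy : leafy.

(** Mayer-Vietoris at a leaf [v] with neighbour [w], in explicit chains: if the trace of the cycle
    on the link of [w] bounds, the cycle can be moved off [w] and then coned off with apex [v];
    otherwise the link supplies a matching that the edge [wv] lengthens. *)
Lemma ind_cocycle N m f : ind_supp N f -> (forall F, f F != 0 -> #|~: F| = m) ->
  diff f = 0 ->
  (exists g, ind_supp N g /\ f = diff g) \/
  (exists L, induced_matching N L /\ size L = m).
Proof.
move: {2}_.+1 (ltnSn #|~: N|) => q; elim: q N m f => // q IH N [|m] f leq_q fN fm df.
  by right; exists [::].
(* Without edges the complex is a full simplex, hence a cone unless it has no vertex, and then no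
   face has [m.+1] elements. *)
have [edge|noedge] := pselect (exists x y, [/\ x \notin N, y \notin N & h x y]); last first.
  left; have [v vN|NT] := pickP (mem (~: N)).
    rewrite /= inE in vN; exists (contr v f); split; last by rewrite diff_contr df raddf0 subr0.
    apply: ind_supp_cone => // F /fN[NF _]; split=> //; apply/indepP=> x y xF yF.
    apply/negP=> hxy; apply: noedge; exists x, y; split=> //.
      by move: xF; rewrite !inE => /predU1P[->//|]; apply: contra; apply: (subsetP NF).
    by move: yF; rewrite !inE => /predU1P[->//|]; apply: contra; apply: (subsetP NF).
  exists 0; split=> [F|]; first by rewrite ffunE eqxx.
  rewrite raddf0; apply/ffunP=> F; rewrite [RHS]ffunE; apply/eqP/negPn/negP=> nzF.
  have [NF _] := fN F nzF; have := fm F nzF; rewrite (_ : ~: F = set0) ?cards0 //.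
  apply/eqP; rewrite -subset0 -(_ : ~: N = set0) ?setCS //.
  by apply/setP=> x; rewrite [LHS]NT inE.
have [v [w [vN wN hvw leaf]]] := h_leafy edge.
(* [N'] also takes in the closed neighbourhood of [w], so that the independence complex outside [N']
   is the link of [w]. *)
pose N' := [set z | [|| z \in N, z == w | h w z]].
have N'P z : (z \notin N') = [&& z \notin N, z != w & ~~ h w z] by rewrite inE !negb_or.
have NN' : N \subset N' by apply/subsetP=> z zN; rewrite inE zN.
have wN' : w \in N' by rewrite inE eqxx orbT.
have vN' : v \in N' by rewrite inE h_sym hvw !orbT.
have lt_q : (#|~: N'| < q)%N.
  rewrite ltnS in leq_q; apply: leq_trans leq_q; apply: proper_card; rewrite properE setCS NN'.
  by apply/subsetPn; exists w; rewrite !inE ?wN // eqxx orbT.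
(* [wedge w f] keeps the faces of [f] that contain [w] and deletes [w] from them. *)
have BN : ind_supp N' (wedge w f).
  move=> F /wedge_neq0[wF /fN[NF /indepP iF]]; split.
    apply/subsetP=> z; rewrite inE => /or3P[zN|/eqP->//|hwz].
      by have := subsetP NF z zN; rewrite inE => /andP[].
    apply: contraLR hwz => zF; apply: iF; rewrite !inE ?eqxx //=.
    by rewrite (negPf zF) andbF.
  by apply/indepP=> x y xF yF; apply: iF; rewrite !inE negb_and -in_setC ?xF ?yF orbT.
have Bm F : wedge w f F != 0 -> #|~: F| = m.
  case/wedge_neq0=> wF /fm; rewrite setCD setUC cardsU1 !inE wF /= add1n.
  by case.
have dB : diff (wedge w f) = 0 by rewrite diff_wedge df raddf0 oppr0.
have [[g [gN Bg]]|[L [/andP[LN Lsep] sL]]] := IH N' m _ lt_q BN Bm dB; last first.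
  (* Vertices outside [N'] are not adjacent to [w], nor to [v], whose only neighbour outside [N] is
     [w]. *)
  right; exists ((w, v) :: L); rewrite /= sL /induced_matching /= Lsep wN vN h_sym hvw /=.
  have LN' p : p \in L -> [&& p.1 \notin N', p.2 \notin N' & h p.1 p.2] by move/(allP LN).
  have farw x : x \notin N' -> far w x && far v x.
    rewrite N'P => /and3P[xN xw hwx]; rewrite /far eq_sym xw hwx /=; apply/andP; split.
      by apply: contraNneq hwx => <-; rewrite h_sym.
    by apply: contra xw => /leaf -> .
  split=> //; apply/andP; split.
    apply/allP=> p /LN'/and3P[]; rewrite !N'P => /and3P[-> _ _] /and3P[-> _ _] ->.
    by [].
  rewrite andbT; apply/allP=> p /LN'/and3P[/farw/andP[a b] /farw/andP[c d] _].
  by rewrite /sep /= a b c d.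
(* [eps] is homologous to [f] and its faces avoid [w]: [contr w (wedge w f)] is the part of [f] on
   faces through [w], and [g] has no such faces because [w] is in [N']. So [v] can be added to every
   face of [eps], and the cone with apex [v] bounds it. *)
left; pose eps := f + diff (contr w g).
have epsE : eps = f - contr w (wedge w f) + g.
  by rewrite /eps diff_contr -Bg addrA addrAC.
have eps0 F : eps F != 0 -> w \in F /\ (f F != 0 \/ g F != 0).
  move=> nz; have wF : w \in F.
    apply: contraNT nz => wF; rewrite epsE !ffunE (negPf wF) setU11 setU1K // sgnU1_id.
    rewrite mulrA sgn_sq mul1r subrr add0r.
    by apply: contraNT wF => /gN[/subsetP NF _]; apply: NF.
  split=> //; move: nz; rewrite epsE !ffunE wF subr0 => nz.
  by have [f0|] := eqVneq (f F) 0; [right; rewrite f0 add0r in nz|left].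
have deps : diff eps = 0 by rewrite raddfD /= df diff_sq addr0.
have epsd : eps = diff (contr v eps) by rewrite diff_contr deps raddf0 subr0.
have epsN F : eps F != 0 -> w \in F /\ (N \subset F /\ indep (~: F)).
  move/eps0 => [wF [/fN//|/gN[N'F iF]]]; split=> //; split=> //.
  exact: subset_trans N'F.
exists (contr v eps - contr w g); split; last first.
  by rewrite raddfB /= -epsd /eps addrK.
have sv : ind_supp N (contr v eps).
  apply: ind_supp_cone => // F /epsN[wF [NF /indepP iF]]; split=> //.
  have nv x : x \in ~: F -> ~~ h v x.
    move=> xF; apply/negP=> hvx; have xw : x = w.
      by apply: leaf hvx; apply: contraL xF => xN; rewrite inE negbK (subsetP NF).
    by rewrite xw inE wF in xF.
  apply/indepP=> x y /setU1P[->|xF] /setU1P[->|yF]; rewrite ?h_irr ?nv //.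
    by rewrite h_sym nv.
  exact: iF.
have sw : ind_supp N (contr w g).
  apply: ind_supp_cone => // F /gN[N'F /indepP iF]; split; first exact: subset_trans N'F.
  have nw x : x \in ~: F -> ~~ h w x.
    rewrite inE; apply: contra => hwx; apply: (subsetP N'F).
    by rewrite inE hwx !orbT.
  apply/indepP=> x y /setU1P[->|xF] /setU1P[->|yF]; rewrite ?h_irr ?nw //.
    by rewrite h_sym nw.
  exact: iF.
move=> F; rewrite !ffunE => nz.
have [z|/sv//] := eqVneq (contr v eps F) 0.
have [z'|/sw//] := eqVneq (contr w g F) 0.
by move: nz; move: z z'; rewrite !ffunE => -> ->; rewrite subr0 eqxx.
Qed.

(** This inverts the connecting map of the pair (simplex, independence complex): [diff f] is a cycle
    on independent faces with [n - p.+1] vertices. Without a matching of that size it is [diff g]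
    with [g] on independent faces; then [f - g] is a cycle of the full simplex, bounded by a cone,
    and agrees with [f] on dependent faces. *)
Lemma rel_cocycle N p f :
  (forall F, f F != 0 -> N \subset F /\ #|F| = p) ->
  (forall F, #|F| = p.+1 -> N \subset F -> ~~ indep (~: F) -> diff f F = 0) ->
  (forall L, induced_matching N L -> size L <> (n - p.+1)%N) ->
  exists g, (forall F, g F != 0 -> N \subset F) /\
    forall F, N \subset F -> ~~ indep (~: F) -> f F = diff g F.
Proof.
move=> fN df noL; have [v vN|NT] := pickP (mem (~: N)); last first.
  exists 0; split=> [F|F NF]; first by rewrite ffunE eqxx.
  case/indepPn=> x [y [+ _ _]]; rewrite inE => xF; have := NT x.
  by rewrite /= inE => /negbT/negPn xN; rewrite (subsetP NF) in xF.
have dfN F : diff f F != 0 -> N \subset F /\ #|F| = p.+1.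
  case/diff_neq0=> j jF /fN[NF Fp]; split; first exact: subset_trans NF (subsetDl _ _).
  by rewrite (cardsD1 j) jF Fp.
have dfi : ind_supp N (diff f).
  move=> F nz; have [NF Fp] := dfN F nz; split=> //.
  by apply: contraNT nz => iF; rewrite df.
have dfm F : diff f F != 0 -> #|~: F| = (n - p.+1)%N.
  by case/dfN=> _ Fp; rewrite cardsCs setCK card_ord Fp.
have [[g [gN dfg]]|[L [/noL]]] := ind_cocycle dfi dfm (diff_sq f); last by [].
rewrite /= inE in vN; exists (contr v (f - g)); split=> [F|F NF iF].
  move/contr_neq0=> [_ nz]; apply: (subset_contr vN); move: nz; rewrite !ffunE.
  have [f0|/fN[]//] := eqVneq (f (v |: F)) 0.
  by rewrite f0 sub0r oppr_eq0 => /gN[].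
have [g0|/gN[_ iF']] := eqVneq (g F) 0; last by rewrite iF' in iF.
rewrite diff_contr raddfB /= dfg subrr raddf0 subr0 !ffunE.
by rewrite g0 subr0.
Qed.

End LeafInduction.

(** * Leaves and bipartitions of forests *)

Section Forests.
Variables (n : nat) (h : rel 'I_n).
Hypotheses (h_sym : ssrbool.symmetric h) (h_irr : irreflexive h).

(** Take a longest path outside [N]: a second neighbour of its first vertex would prolong the path
    or close a cycle. *)
Lemma forest_leafy : is_forest h -> leafy h.
Proof.
move=> forest N [x0 [y0 [x0N y0N hxy0]]].
pose h' x y := [&& x \notin N, y \notin N & h x y].
have sub x y : h' x y -> h x y by case/and3P.
pose P k := `[< exists x s, [/\ path h' x s, uniq (x :: s) & size s = k] >].
have P1 : P 1%N.
  apply/asboolP; exists x0, [:: y0]; split=> //=.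
    by rewrite /h' x0N y0N hxy0.
  by rewrite inE andbT; apply: contraTneq hxy0 => ->; rewrite h_irr.
have exP : exists k, P k by exists 1%N.
have bndP k : P k -> (k <= n)%N.
  case/asboolP=> x [s [_ /card_uniqP us <-]].
  by have := max_card (mem (x :: s)); rewrite us card_ord => /ltnW.
case: (ex_maxnP exP bndP) => k /asboolP[x [s [px us sk]]] maxk.
have k_gt0 : (0 < k)%N by apply: maxk P1.
case: s px us sk => [|y s] px us sk; first by rewrite -sk in k_gt0.
have /and3P[xN yN hxy] : h' x y by case/andP: px.
exists x, y; split=> // z zN hxz; apply/eqP/negPn/negP=> zy.
have zx : z != x by apply: contraTneq hxz => ->; rewrite h_irr.
have [zs|zs] := boolP (z \in s); last first.
  have : P k.+1.
    apply/asboolP; exists z, (x :: y :: s); split; rewrite /= -?sk //.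
      by rewrite {1}/h' zN xN h_sym hxz.
    by move: us; rewrite /= => ->; rewrite !inE !negb_or zx zy zs.
  by move/maxk; rewrite ltnn.
case/splitPr: zs px us {sk} => s1 s2 px us.
apply: (forest [:: x, y & rcons s1 z]); first by rewrite /= size_rcons.
have px' : path h' x (y :: rcons s1 z).
  by move: px; rewrite -cat_rcons -cat_cons cat_path => /andP[].
apply/andP; split.
  rewrite /= rcons_path last_rcons [h z x]h_sym hxz andbT; exact: (sub_path sub px').
by move: us; rewrite -cat_rcons -!cat_cons cat_uniq => /andP[].
Qed.

(** Remove a leaf, colour the rest, and give the leaf the colour opposite to that of its
    neighbour. *)
Lemma leafy_bipartite : leafy h ->
  exists col : 'I_n -> bool, forall x y, h x y -> col x != col y.
Proof.
move=> lf; suff H q N : (#|~: N| < q)%N ->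
    exists col : 'I_n -> bool, forall x y,
      x \notin N -> y \notin N -> h x y -> col x != col y.
  have [col colP] := H #|~: (@set0 'I_n)|.+1 set0 (ltnSn _).
  by exists col => x y; apply: colP; rewrite inE.
elim: q N => // q IH N; rewrite ltnS => leq_q.
have [edge|noedge] := pselect (exists x y, [/\ x \notin N, y \notin N & h x y]); last first.
  by exists (fun=> true) => x y xN yN hxy; case: noedge; exists x, y.
have [v [w [vN wN hvw leaf]]] := lf N edge.
have vw : w != v by apply: contraTneq hvw => ->; rewrite h_irr.
have [col colP] : exists col : 'I_n -> bool, forall x y,
    x \notin v |: N -> y \notin v |: N -> h x y -> col x != col y.
  apply: IH; apply: leq_trans leq_q; apply: proper_card.
  rewrite properE setCS subsetUr /=; apply/subsetPn.
  by exists v; rewrite !inE ?vN // eqxx.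
exists (fun x => if x == v then ~~ col w else col x) => x y xN yN hxy.
have [xv|xv] := eqVneq x v; have [yv|yv] := eqVneq y v.
- by rewrite xv yv h_irr in hxy.
- by rewrite xv in hxy; rewrite (leaf y yN hxy); case: (col w).
- by rewrite yv h_sym in hxy; rewrite (leaf x xN hxy); case: (col w).
by apply: colP => //; rewrite !inE negb_or ?xv ?yv ?xN ?yN.
Qed.

End Forests.

(** * From induced matchings in one degree to ordered matchings *)

Section Matchings.
Variables (n : nat) (e : rel 'I_n).
Hypotheses (e_sym : ssrbool.symmetric e) (e_irr : irreflexive e).
Implicit Types (M : {set {set 'I_n}}) (a : 'I_n -> nat) (t : nat).

Definition deg_graph a t : rel 'I_n := fun x y => e x y && (a x + a y < t)%N.

Lemma deg_graph_sym a t : ssrbool.symmetric (deg_graph a t).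
Proof. by move=> x y; rewrite /deg_graph e_sym addnC. Qed.

Lemma deg_graph_irr a t : irreflexive (deg_graph a t).
Proof. by move=> x; rewrite /deg_graph e_irr. Qed.

Lemma set2_inj (T : finType) (x y u v : T) : [set x; y] = [set u; v] ->
  (x = u /\ y = v) \/ (x = v /\ y = u).
Proof.
move=> E.
have /set2P hx : x \in [set u; v] by rewrite -E set21.
have /set2P hy : y \in [set u; v] by rewrite -E set22.
have /set2P hu : u \in [set x; y] by rewrite E set21.
have /set2P hv : v \in [set x; y] by rewrite E set22.
by case: hx hy hu hv => -> [] -> [] hu [] hv; subst; first [by left | by right].
Qed.

(* Along an alternating walk with q edges in M, the degrees of the M-edges add up
   to at most q (t - 1), while those of the other q - 1 edges add up to at least
   (q - 1) t. *)
Lemma alternating_bound M a t x s :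
  (forall y z, [set y; z] \in M -> (a y + a z < t)%N) ->
  (forall w y z w', e y z -> [set w; y] \in M -> [set z; w'] \in M ->
     [set y; z] \notin M -> (t <= a y + a z)%N) ->
  is_alternating e M x s ->
  (2 * (a x + a (last x s)) + (size s).+1 <= 2 * t)%N.
Proof.
move=> C1 C2; move: {2}_.+1 (ltnSn (size s)) => q.
elim: q x s => // q IH x [|y [|z [|w s]]] lq; rewrite /is_alternating /= ?andbF //.
- by case/and3P=> _ /C1; lia.
- by case/and4P=> _ + b1 b2; rewrite b1 b2.
case/and4P=> /and4P[exy eyz ezw ps] /and3P[b12 b23 srt] b1 bl.
have b2 : [set y; z] \in M = false by move: b12; rewrite b1; case: (_ \in M).
have b3 : [set z; w] \in M by move: b23; rewrite b2; case: (_ \in M).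
have := C1 _ _ b1; have := C2 _ _ _ _ eyz b1 b3; rewrite b2 => /(_ isT).
have /IH : (size (w :: s) < q)%N by move: lq => /=; lia.
have alt : is_alternating e M z (w :: s).
  by move: srt bl; rewrite /is_alternating /= ezw ps b3 => -> ->.
by move=> /(_ _ alt) /=; lia.
Qed.

(** List the edges by increasing degree of the second vertex. If a first vertex were adjacent in [e]
    to the second vertex of an earlier edge, their degree sum would be at least [t] because the
    matching is induced; the later edge itself would then have sum at least [t]. *)
Lemma induced_matching_alpha a t L : (0 < t)%N ->
  induced_matching (deg_graph a t) set0 L ->
  {in L &, forall p q, ~~ e p.1 q.1} ->
  (size L <= alpha e t)%N.
Proof.
move=> t_gt0 /andP[/allP edgeL sepL] indL.
have edgeP p : p \in L -> e p.1 p.2 /\ (a p.1 + a p.2 < t)%N.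
  by case/edgeL/and3P=> _ _ /andP[].
have sepP : {in L &, forall p q, p != q -> sep (deg_graph a t) p q}.
  by apply: pairwise_in sepL; apply/sep_sym/deg_graph_sym.
have uniqL : uniq L.
  by apply: pairwise_uniq sepL => p; rewrite /sep /far eqxx.
pose M := [set [set p.1; p.2] | p in L].
have MP A : reflect (exists2 p, p \in L & A = [set p.1; p.2]) (A \in M) by apply: imsetP.
have cardM : #|M| = size L.
  rewrite card_in_imset ?(card_uniqP uniqL) // => p q pL qL /set2_inj E.
  apply/eqP/negPn/negP => pq; have := sepP p q pL qL pq.
  by rewrite /sep /far; case: E => -[-> _]; rewrite eqxx //= andbF.
have E12 p : p \in L -> p.1 != p.2.
  by case/edgeP=> e12 _; apply: contraTneq e12 => ->; rewrite e_irr.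
pose ord := fun p q : 'I_n * 'I_n => (a p.2 <= a q.2)%N.
pose sL := sort ord L.
have memsL : sL =i L by apply: mem_sort.
have ssL : size sL = #|M| by rewrite cardM size_sort.
have M_matching : is_ordered_matching e M.
  split.
    apply/andP; split.
      apply/subsetP=> _ /imsetP[p pL ->]; apply/imsetP; exists p => //.
      by rewrite inE; case: (edgeP p pL).
    apply/trivIsetP=> _ _ /imsetP[p pL ->] /imsetP[q qL ->] pq.
    have /(sepP p q pL qL)/and4P[] : p != q by apply: contraNneq pq => ->.
    move=> /andP[f1 _] /andP[f2 _] /andP[f3 _] /andP[f4 _].
    rewrite disjoint_subset; apply/subsetP=> x /set2P[]->; rewrite !inE negb_or.
      by rewrite f1 f2.
    by rewrite f3 f4.
  exists (fun i => (tnth (in_tuple sL) (cast_ord (esym ssL) i)).1),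
         (fun i => (tnth (in_tuple sL) (cast_ord (esym ssL) i)).2).
  have tL i : tnth (in_tuple sL) i \in L by rewrite -memsL mem_tnth.
  split=> [|i j|i j].
  - apply/setP=> A; apply/MP/imsetP=> [[p pL ->]|[i _ ->]]; last first.
      by exists (tnth (in_tuple sL) (cast_ord (esym ssL) i)).
    have /tnthP[i ->] : p \in in_tuple sL by rewrite memsL.
    by exists (cast_ord ssL i) => //; rewrite cast_ordK.
  - exact: indL.
  set i' := cast_ord _ i; set j' := cast_ord _ j => eij; rewrite leqNgt; apply/negP => ji.
  have ij' : i' != j' by rewrite -(inj_eq val_inj) /= neq_ltn ji orbT.
  have [x0 _] : exists2 x0 : 'I_n * 'I_n, x0 \in L & true by exists (tnth (in_tuple sL) i').
  have pq : tnth (in_tuple sL) i' != tnth (in_tuple sL) j'.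
    by rewrite !(tnth_nth x0) /= nth_uniq ?sort_uniq // ssL.
  have := sepP _ _ (tL i') (tL j') pq; case/and4P=> _ /andP[_ +] _ _.
  rewrite /deg_graph eij /= -leqNgt => le_t.
  have [_ lt_i] := edgeP _ (tL i').
  have le_ji : (a (tnth (in_tuple sL) j').2 <= a (tnth (in_tuple sL) i').2)%N.
    have ord_tr : transitive ord by move=> q p r; apply: leq_trans.
    have ord_total : total ord by move=> p q; apply: leq_total.
    rewrite !(tnth_nth x0); apply: (sorted_leq_nth ord_tr _ x0 (sort_sorted ord_total L)).
    - by move=> p; apply: leqnn.
    - by rewrite inE /= ssL.
    - by rewrite inE /= ssL.
    exact: ltnW.
  have := leq_ltn_trans (leq_add (leqnn (a _)) le_ji) lt_i.
  by rewrite ltnNge le_t.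
apply: leq_trans (leq_bigmax_cond M _); first by rewrite cardM.
apply/asboolP; split=> // x s alt.
suff : (2 * (a x + a (last x s)) + (size s).+1 <= 2 * t)%N by lia.
apply: alternating_bound alt => [y z /MP[p pL]|w y z w' eyz /MP[p pL Ep] /MP[q qL Eq] nyz].
  by case/set2_inj=> -[-> ->]; have [_] := edgeP p pL; rewrite // addnC.
have yp : y \in [set p.1; p.2] by rewrite -Ep set22.
have zq : z \in [set q.1; q.2] by rewrite -Eq set21.
(* An edge of the walk outside [M] joins two different matching edges; these are separated in the
   degree graph, so its degree sum is at least [t]. *)
have [pq|/(sepP p q pL qL)/and4P[]] := eqVneq p q.
  case/negP: nyz; apply/MP; exists p => //; rewrite -pq in zq.
  move: yp zq eyz => /set2P[]-> /set2P[]->; rewrite ?e_irr //.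
  by rewrite setUC.
move=> /andP[_ f1] /andP[_ f2] /andP[_ f3] /andP[_ f4].
have : ~~ deg_graph a t y z by move: yp zq => /set2P[]-> /set2P[]->.
by rewrite /deg_graph eyz /= -leqNgt.
Qed.

End Matchings.

(** * Alternating walks through matching edges *)

Section Walks.
Variables (n : nat) (e : rel 'I_n) (M : {set {set 'I_n}}).

Definition unmatched_edge (p q : 'I_n * 'I_n) : bool :=
  e p.2 q.1 && ([set p.2; q.1] \notin M).

(** Each pair is an oriented matching edge; the resulting walk has one edge for [p] and two more for
    each element of [ps]. *)
Lemma alternating_walk p ps :
  all (fun q => ([set q.1; q.2] \in M) && e q.1 q.2) (p :: ps) ->
  path unmatched_edge p ps ->
  is_alternating e M p.1 (p.2 :: flatten [seq [:: q.1; q.2] | q <- ps]).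
Proof.
elim: ps p => [|q ps IH] p; first by rewrite /is_alternating /= andbT => /andP[-> ->].
move=> /= /andP[/andP[pM ep] qps] /andP[/andP[epq pqM] pth].
move: (IH q qps pth); rewrite /is_alternating /= ep epq /= pM (negPf pqM) /=.
by case/and4P=> -> -> -> ->.
Qed.

End Walks.

(** * From ordered matchings to induced matchings in one degree *)

Section OrderedMatchings.
Variables (n : nat) (e : rel 'I_n).
Hypotheses (e_sym : ssrbool.symmetric e) (e_irr : irreflexive e).

(* With D i the maximal length of a chain i = i_0, i_1, ... such that u_(i_s) is
   adjacent to v_(i_(s+1)), the degrees D i at u_i and t - 1 - D i at v_i isolate
   the matching. *)
Lemma ordered_matching_induced M t : (0 < t)%N ->
  is_ordered_matching e M -> ell_le e M (2 * t - 1) ->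
  exists a L, induced_matching (deg_graph e a t) set0 L /\ size L = #|M|.
Proof.
move=> t_gt0 [/andP[/subsetP M_edges /trivIsetP M_triv] [u [v [ME u_indep _]]]] ellM.
pose S i := [set u i; v i].
have S_inj : injective S.
  have /imset_injP H : #|S @: predT| == #|predT : pred 'I_#|M| |.
    by rewrite -ME card_ord.
  by move=> i j; apply: H.
have MS A : (A \in M) = (A \in [set [set u i; v i] | i : 'I_#|M|]) by rewrite -ME.
have SM i : S i \in M by rewrite MS imset_f.
have uv_edge i : e (u i) (v i).
  have /imsetP[[x y]] := M_edges _ (SM i); rewrite inE /= => exy /set2_inj.
  by case=> -[-> ->]; rewrite // e_sym.
have S_disj i j x : i != j -> x \in S i -> x \notin S j.
  move=> ij xi; have dis : [disjoint S i & S j].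
    by apply: M_triv; rewrite ?SM ?(inj_eq S_inj).
  by apply/negP=> xj; case/pred0Pn: dis; exists x; rewrite /= xi xj.
have u_vN i : u i != v i by apply: contraTneq (uv_edge i) => ->; rewrite e_irr.
have uv i j : u i != v j.
  have [<-//|ij] := eqVneq i j.
  by have := S_disj i j (u i) ij (set21 _ _); rewrite !inE negb_or => /andP[].
have u_inj : injective u.
  move=> i j E; apply/eqP/negPn/negP => ij.
  by have := S_disj i j (u i) ij (set21 _ _); rewrite E set21.
have v_inj : injective v.
  move=> i j E; apply/eqP/negPn/negP => ij.
  by have := S_disj i j (v i) ij (set22 _ _); rewrite E set22.
have matchE x y i j : x \in S i -> y \in S j -> i != j -> [set x; y] \notin M.
  move=> xi yj ij; rewrite MS; apply/imsetP => -[l _ E].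
  have xl : x \in S l by rewrite /S -E set21.
  have yl : y \in S l by rewrite /S -E set22.
  have il : i = l by apply/eqP/negPn/negP=> /S_disj/(_ xi); rewrite xl.
  have jl : j = l by apply/eqP/negPn/negP=> /S_disj/(_ yj); rewrite yl.
  by rewrite il jl eqxx in ij.
pose g i j := (i != j) && e (u i) (v j).
(* The flag chooses the direction in which an edge is traversed, so that chains of [g] can be
   followed forwards ([true]) or backwards ([false]). *)
pose o (x : bool * 'I_#|M|) := if x.1 then (v x.2, u x.2) else (u x.2, v x.2).
have oM xs : all (fun q => ([set q.1; q.2] \in M) && e q.1 q.2) (map o xs).
  rewrite all_map; apply/allP=> -[[] i] _ /=; last by rewrite SM uv_edge.
  by rewrite setUC SM e_sym uv_edge.
(* A walk through [q + 1] matching edges has length [2q + 1], so the bound [2t - 1] gives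
   [q < t]. *)
have walk x xs : path (relpre o (unmatched_edge e M)) x xs -> (size xs < t)%N.
  rewrite -path_map => /(alternating_walk (oM (x :: xs)))/ellM /=.
  have -> : size (flatten [seq [:: q.1; q.2] | q <- map o xs]) = (2 * size xs)%N.
    by elim: (xs) => //= _ s ->; lia.
  have aux m : (2 * m < 2 * t - 1)%N -> (m < t)%N by clear -t_gt0; lia.
  exact: aux.
have g_link i j : g i j -> unmatched_edge e M (o (true, i)) (o (true, j)).
  case/andP=> ij euv; rewrite /unmatched_edge /= euv.
  by rewrite (matchE _ _ i j) ?set21 ?set22.
have g_link' i j : g i j -> unmatched_edge e M (o (false, j)) (o (false, i)).
  case/andP=> ij euv; rewrite /unmatched_edge /= e_sym euv.
  by rewrite (matchE _ _ j i) ?set21 ?set22 // eq_sym.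
have chain i s : path g i s -> (size s < t)%N.
  move=> gs; rewrite -(size_map (pair true)).
  apply: (walk (true, i)); rewrite path_map; apply: sub_path gs => x y; exact: g_link.
(* Run the chain of [i] backwards until [v i], cross to [v j], and run the chain of [j] forwards. *)
have chain2 i j s s' : path g i s -> path g j s' -> i != j -> e (v i) (v j) ->
    ((size s + size s').+1 < t)%N.
  move=> gs gs' ij evv.
  have -> : (size s + size s').+1 =
      size ([seq (false, x) | x <- rev (belast i s)] ++ [seq (true, x) | x <- j :: s']).
    by rewrite size_cat !size_map size_rev size_belast /= addnS.
  apply: (walk (false, last i s)); rewrite cat_path; apply/andP; split.
    rewrite path_map rev_path; apply: sub_path gs => x y; exact: g_link'.
  have -> : last (false, last i s) [seq (false, x) | x <- rev (belast i s)] = (false, i).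
    rewrite last_map; congr pair; case: s {gs} => //= x s.
    by rewrite rev_cons last_rcons.
  rewrite /= path_map; apply/andP; split; last by apply: sub_path gs' => x y; exact: g_link.
  by rewrite /unmatched_edge /= evv (matchE _ _ i j) ?set22.
have /choice[D DP] : forall i, exists d,
    (exists2 s, path g i s & size s = d) /\ (forall s, path g i s -> (size s <= d)%N).
  move=> i; pose P m := `[< exists2 s, path g i s & size s = m >].
  have exP : exists m, P m by exists 0%N; apply/asboolP; exists [::].
  have bndP m : P m -> (m <= t)%N by case/asboolP=> s /chain/ltnW + <-.
  case: (ex_maxnP exP bndP) => m /asboolP Pm maxm; exists m; split=> // s gs.
  by apply: maxm; apply/asboolP; exists s.
have Dt i : (D i < t)%N by have [[s /chain + <-] _] := DP i.
have Dg i j : g i j -> (D j < D i)%N.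
  have [[s gs <-] _] := DP j; have [_ H] := DP i => gij.
  by apply: (H (j :: s)); rewrite /= gij.
have Dv i j : i != j -> e (v i) (v j) -> ((D i + D j).+1 < t)%N.
  have [[s gs <-] _] := DP i; have [[s' gs' <-] _] := DP j.
  exact: chain2.
pose a x := if [pick i | v i == x] is Some i then (t.-1 - D i)%N
            else if [pick i | u i == x] is Some i then D i else 0%N.
have av i : a (v i) = (t.-1 - D i)%N.
  by rewrite /a; case: pickP => [j /eqP/v_inj -> //|/(_ i)]; rewrite eqxx.
have au i : a (u i) = D i.
  rewrite /a; case: pickP => [j /eqP E|_]; first by have := uv i j; rewrite E eqxx.
  by case: pickP => [j /eqP/u_inj -> //|/(_ i)]; rewrite eqxx.
exists a, [seq (u i, v i) | i <- enum 'I_#|M|]; rewrite size_map size_enum_ord; split=> //.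
apply/andP; split.
  apply/allP=> _ /mapP[i _ ->]; rewrite !inE /= /deg_graph uv_edge au av /=.
  by have := Dt i; lia.
rewrite pairwise_map; have := enum_uniq 'I_#|M|; rewrite uniq_pairwise.
apply: sub_pairwise => i j /= ij.
(* Such an edge of [e] gives [D j' < D i'], so its degree sum [D i' + (t - 1 - D j')] is at least
   [t]. *)
have uvij i' j' : i' != j' -> ~~ deg_graph e a t (u i') (v j').
  move=> ij'; rewrite /deg_graph au av; apply/negP=> /andP[euv].
  have /Dg : g i' j' by rewrite /g ij'.
  by have := Dt i'; have := Dt j'; lia.
rewrite /sep /far /= !uv (inj_eq u_inj) (inj_eq v_inj) ij /= [v i == _]eq_sym !uv /=.
rewrite [deg_graph _ _ _ (v i) (u j)]deg_graph_sym // !uvij ?(eq_sym j) //.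
rewrite {1}/deg_graph (negPf (u_indep i j)) /=.
(* An edge between [v i] and [v j] forces [D i + D j <= t - 2], so its degree sum
   [2(t - 1) - D i - D j] is at least [t]. *)
apply/negP=> /andP[/(Dv _ _ ij)]; rewrite !av.
by have := Dt i; have := Dt j; lia.
Qed.

End OrderedMatchings.

(** * The cross-polytope of an induced matching *)

Section CrossPolytope.
Variables (R : comNzRingType) (n : nat) (h : rel 'I_n).
Hypotheses (h_sym : ssrbool.symmetric h) (h_irr : irreflexive h).
Implicit Types (F : {set 'I_n}) (L : seq ('I_n * 'I_n)).

Definition vertices L : {set 'I_n} :=
  [set x | has (fun p => (x == p.1) || (x == p.2)) L].

(** The indicator of [setT] is the empty face. Joining it with the difference of the two vertices of
    each pair yields the fundamental cycle of the cross-polytope. *)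
Fixpoint cross L : {ffun {set 'I_n} -> R} :=
  if L is p :: L' then contr p.1 (cross L') - contr p.2 (cross L')
  else [ffun F => (F == setT)%:R].

Lemma diff_cross L : diff (cross L) = 0.
Proof.
elim: L => [|p L IH] /=; last first.
  by rewrite raddfB /= !diff_contr IH !raddf0 ?subr0 ?addr0 subrr.
apply/ffunP=> F; rewrite diffE ffunE big1 // => j _; rewrite ffunE.
suff /negPf-> : F :\ j != setT by rewrite mulr0.
by apply/eqP=> /setP/(_ j); rewrite !inE eqxx.
Qed.

Lemma card_setC_U1 F x : x \notin F -> #|~: F| = #|~: (x |: F)|.+1.
Proof.
move=> xF; rewrite (cardsD1 x) inE xF add1n; congr _.+1; apply: eq_card => y.
by rewrite !inE negb_or.
Qed.

Lemma in_vertices L p : p \in L -> p.1 \in vertices L /\ p.2 \in vertices L.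
Proof.
by move=> pL; split; rewrite inE; apply/hasP; exists p; rewrite ?eqxx ?orbT.
Qed.

Lemma sep_vertices p L x : all (sep h p) L -> x \in vertices L ->
  far h p.1 x && far h p.2 x.
Proof.
move=> /allP pL; rewrite inE => /hasP[q /pL/and4P[f1 f2 f3 f4]].
by case/orP=> /eqP->; rewrite ?f1 ?f2 ?f3 ?f4.
Qed.

(** Each factor puts one vertex of its pair [p] into the face, and neither vertex of [p] occurs in
    the other pairs. *)
Lemma cross_supp L F : induced_matching h set0 L -> cross L F != 0 ->
  [/\ ~: F \subset vertices L, #|~: F| = size L &
      {in L, forall p, (p.1 \in F) || (p.2 \in F)}].
Proof.
elim: L F => [|p L IH] F /=.
  rewrite ffunE => _; have [->|_] := eqVneq F setT; last by rewrite eqxx.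
  by rewrite setCT cards0 sub0set.
case/andP=> /= /andP[/and3P[_ _ hp] LN] /andP[pL sepL].
have {}IH G := IH G (introT andP (conj LN sepL)).
have p12 : p.1 != p.2 by apply: contraTneq hp => ->; rewrite h_irr.
have npL : p.1 \notin vertices L /\ p.2 \notin vertices L.
  split; apply/negP=> /(sep_vertices pL); rewrite /far eqxx //=.
  by rewrite andbF.
(* Both terms are treated at once: [x] is the vertex of [p] put into the face, [y] the other one. *)
have key x y : [|| (x == p.1) && (y == p.2) | (x == p.2) && (y == p.1)] ->
    contr x (cross L) F != 0 ->
  [/\ ~: F \subset vertices (p :: L), #|~: F| = (size L).+1,
      {in L, forall p, (p.1 \in F) || (p.2 \in F)} & y \in F].
  move=> xy /contr_neq0[xF /IH[/subsetP FL cF pF]].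
  have nyL : y \notin vertices L by case: npL; case/orP: xy => /andP[_ /eqP->].
  have nxL : x \notin vertices L by case: npL; case/orP: xy => /andP[/eqP->].
  have yx : (y == x) = false.
    case/orP: xy => /andP[/eqP-> /eqP->]; rewrite ?(negPf p12) //.
    by rewrite eq_sym (negPf p12).
  split.
  - apply/subsetP=> z zF; rewrite !inE /=; have [zx|zx] := eqVneq z x.
      by rewrite zx; case/orP: xy => /andP[/eqP-> _]; rewrite eqxx ?orbT.
    by apply/orP; right; have := FL z; rewrite !inE negb_or zx -in_setC zF; apply.
  - by rewrite (card_setC_U1 xF) cF.
  - move=> q qL; have [q1 q2] := in_vertices qL.
    have := pF q qL; rewrite !inE.
    have -> : (q.1 == x) = false by apply: contraNF nxL => /eqP <-.
    by have -> : (q.2 == x) = false by apply: contraNF nxL => /eqP <-.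
  by apply: contraNT nyL => yF; apply: FL; rewrite !inE yx.
rewrite !ffunE => nz.
have [z1|nz1] := eqVneq (contr p.1 (cross L) F) 0.
  have [||sub cF LF p1F] := key p.2 p.1; first by rewrite !eqxx orbT.
    by apply: contraNneq nz => z2; move: z1 z2; rewrite !ffunE => -> ->; rewrite subr0.
  split=> // q; rewrite inE => /predU1P[->|/LF//]; by rewrite p1F.
have [|sub cF LF p2F] := key p.1 p.2 _ nz1; first by rewrite !eqxx.
split=> // q; rewrite inE => /predU1P[->|/LF//]; by rewrite p2F orbT.
Qed.

Definition firsts L : {set 'I_n} := [set x | x \notin map fst L].

(** Only the choice of the first vertex in every pair yields this facet, so its coefficient is a
    product of signs. *)
Lemma cross_firsts L : induced_matching h set0 L -> cross L (firsts L) != 0.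
Proof.
elim: L => [|p L IH] /=.
  by rewrite ffunE => _; rewrite (_ : firsts [::] = setT) ?eqxx ?oner_neq0.
case/andP=> /= /andP[/and3P[_ _ hp] LN] /andP[pL sepL].
have {}IH := IH (introT andP (conj LN sepL)).
have p12 : p.2 != p.1 by apply: contraTneq hp => ->; rewrite h_irr.
have np x : x \in [:: p.1; p.2] -> x \in firsts L.
  move=> xp; rewrite inE; apply/mapP=> -[q /(allP pL)/and4P[/andP[f1 _] _ /andP[f2 _] _] E].
  move: xp f1 f2; rewrite -E !inE => /orP[]/eqP->; by rewrite eqxx.
have E : p.1 |: firsts (p :: L) = firsts L.
  apply/setP=> x; rewrite !inE /=; have [->|//] := eqVneq x p.1.
  by have := np p.1; rewrite !inE eqxx => /(_ isT) ->.
rewrite !ffunE E {1}/firsts inE /= inE eqxx /= {2}/firsts inE /= inE negb_or p12.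
have := np p.2; rewrite !inE eqxx orbT => /(_ isT) -> /=; rewrite subr0.
apply: contraNneq IH => /(congr1 ( *%R (sgn R (firsts (p :: L)) p.1))).
by rewrite mulrA sgn_sq mul1r mulr0 => ->.
Qed.

Lemma pair_pigeonhole L F : F \subset vertices L ->
  (forall p, p \in L -> ~~ ((p.1 \in F) && (p.2 \in F))) -> (#|F| <= size L)%N.
Proof.
elim: L F => [|p L IH] F FL Fp.
  suff -> : F = set0 by rewrite cards0.
  by apply/setP=> x; rewrite in_set0; apply/negP=> /(subsetP FL); rewrite inE.
have le : (#|F :\ p.1 :\ p.2| <= size L)%N.
  apply: IH => [|q qL].
    apply/subsetP=> x; rewrite !inE => /and3P[x2 x1 xF].
    by have := subsetP FL x xF; rewrite inE /= (negPf x1) (negPf x2).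
  apply: contra (Fp q _); last by rewrite inE qL orbT.
  by rewrite !inE => /andP[/and3P[_ _ ->] /and3P[_ _ ->]].
apply: leq_trans (_ : (#|F :\ p.1 :\ p.2|.+1 <= _)%N); last by rewrite ltnS.
have := Fp p (mem_head _ _); rewrite (cardsD1 p.1 F) (cardsD1 p.2 (F :\ p.1)) !inE.
by case: (p.1 \in F); case: (p.2 \in F); rewrite ?andbF ?andbT //=; case: eqP.
Qed.

(** [z] is a cone over the cross-polytope, so [diff z] is the fundamental cycle, carried by
    independent faces. Were [z] a relative boundary [diff g], this nonzero cycle would be
    [diff (diff g)]. *)
Lemma cross_cocycle L : induced_matching h set0 L -> L != [::] ->
  exists z : {ffun {set 'I_n} -> R},
  [/\ forall F, z F != 0 -> ~: vertices L \subset F /\ #|~: F| = (size L).+1,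
      forall F, ~~ indep h (~: F) -> diff z F = 0 &
      forall g : {ffun {set 'I_n} -> R},
        (forall F, g F != 0 -> ~: vertices L \subset F) ->
        ~ (forall F, ~: vertices L \subset F -> ~~ indep h (~: F) ->
             #|~: F| = (size L).+1 -> z F = diff g F)].
Proof.
move=> L_ind L_neq0.
have [x xL] : exists x, x \in vertices L.
  by case: L {L_ind} L_neq0 => // p L _; exists p.1; rewrite inE /= eqxx.
have dz : diff (contr x (cross L)) = cross L by rewrite diff_contr diff_cross raddf0 subr0.
have zF F : contr x (cross L) F != 0 -> ~: vertices L \subset F /\ #|~: F| = (size L).+1.
  case/contr_neq0=> xF /(cross_supp L_ind)[FL cF _]; rewrite (card_setC_U1 xF) cF.
  split=> //; apply: (subset_contr (v := x)); first by rewrite in_setC negbK xL.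
  by rewrite subCset FL.
have /andP[/allP edgeL sepL] := L_ind.
have hL p : p \in L -> h p.1 p.2 by case/edgeL/and3P.
exists (contr x (cross L)); split=> // [F iF|g gN zg].
  rewrite dz; apply/eqP; apply: contraNT iF => /(cross_supp L_ind)[/subsetP FL _ LF].
  apply/indepP=> y w yF wF; apply/negP=> hyw.
  have := FL y yF; have := FL w wF; rewrite !inE => /hasP[q qL qw] /hasP[p pL py].
  have [pq|pq] := eqVneq p q.
    move: yF wF py qw hyw (LF q qL); rewrite pq !inE.
    move=> yF wF /orP[]/eqP Ey /orP[]/eqP Ew; rewrite ?Ey ?Ew ?h_irr //.
      by rewrite -Ey -Ew (negPf yF) (negPf wF).
    by rewrite -Ey -Ew (negPf yF) (negPf wF).
  have := pairwise_in (sep_sym h_sym) sepL pL qL pq.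
  case/and4P=> /andP[_ f1] /andP[_ f2] /andP[_ f3] /andP[_ f4].
  by move: f1 f2 f3 f4; case/orP: py => /eqP <-; case/orP: qw => /eqP <-; rewrite hyw.
(* The equality extends to every [F] of this size: both sides vanish unless [F] contains the
   unmatched vertices, and then the complement has too many elements to avoid containing a whole
   pair. *)
have zall F : #|~: F| = (size L).+1 -> contr x (cross L) F = diff g F.
  move=> cF; have [NF|NF] := boolP (~: vertices L \subset F); last first.
    transitivity (0 : R); first by apply/eqP; apply: contraNT NF => /zF[].
    apply/esym/eqP; apply: contraNT NF => /diff_neq0[j _ /gN NF].
    exact: subset_trans NF (subsetDl _ _).
  apply: zg => //; apply/negP=> /indepP iF; have : (#|~: F| <= size L)%N.
    apply: pair_pigeonhole; first by rewrite -setCS setCK.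
    move=> p pL; apply/negP=> /andP[p1 p2]; have := iF _ _ p1 p2.
    by rewrite hL.
  by rewrite cF ltnn.
have /cross_firsts/negP[] := L_ind.
have [_ cF _] := cross_supp L_ind (cross_firsts L_ind).
rewrite -dz diffE (eq_bigr (fun j => sgn R (firsts L) j * diff g (firsts L :\ j))).
  by rewrite -diffE diff_sq ffunE.
move=> j jF; rewrite zall // (@card_setC_U1 _ j) ?setD11 // setD1K //.
by rewrite cF.
Qed.

End CrossPolytope.

(** * Monomials and denominators *)

Section Monomials.
Variables (k : fieldType) (n : nat).
Local Notation S := {mpoly k[n]}.
Implicit Types (F : {set 'I_n}) (m b : 'X_{1..n}) (p q r : S).

Lemma mcoeffMX_if p m b :
  (p * 'X_[m])@_b = if (m <= b)%MM then p@_(b - m) else 0.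
Proof.
case: ifP => mb; first by rewrite -{1}(submK mb) addmC mcoeffMX.
apply: memN_msupp_eq0; rewrite (perm_mem (msuppMX _ _)); apply/mapP=> -[m' _ E].
by move/negP: mb; apply; apply/mnm_lepP=> i; rewrite E mnmDE leq_addr.
Qed.

Definition box F K : 'X_{1..n} := [multinom (if i \in F then K else 0%N) | i < n].

Lemma boxE F K i : box F K i = if i \in F then K else 0%N.
Proof. by rewrite mnmE. Qed.

Lemma xprod_box F K : xprod (fun i => 'X_i : S) F ^+ K = 'X_[box F K].
Proof.
rewrite /xprod mprodXE mpolyXn; congr 'X_[_]; apply/mnmP=> i.
rewrite mulmnE mnm_sumE boxE; case: ifP => iF.
  rewrite (bigD1 i) //= mnm1E eqxx big1 ?addn0 ?mul1n // => j /andP[_ ji].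
  by rewrite mnm1E (negPf ji).
by rewrite big1 // => j jF; rewrite mnm1E; case: eqP => // ji; rewrite -ji jF in iF.
Qed.

Lemma box_D1 F j K : j \in F -> box (~: (F :\ j)) K = (box (~: F) K + U_(j) *+ K)%MM.
Proof.
move=> jF; apply/mnmP=> i; rewrite mnmDE mulmnE !boxE mnm1E !inE negb_and negbK.
have [->|ij] := eqVneq i j; first by rewrite jF mul1n.
by rewrite addn0.
Qed.

End Monomials.

(** * Symbolic powers and the Cech complex, degree by degree *)

Section CoverPower.
Variables (k : fieldType) (n : nat) (e : rel 'I_n) (t : nat).
Hypotheses (e_sym : ssrbool.symmetric e) (e_irr : irreflexive e).
Local Notation S := {mpoly k[n]}.
Implicit Types (F : {set 'I_n}) (m b : 'X_{1..n}) (p q r : S).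

Definition ord_ge (i j : 'I_n) s : {pred S} :=
  fun r => all (fun m => (s <= m i + m j)%N) (msupp r).

Lemma ord_geP i j s r :
  reflect (forall m, r@_m != 0 -> (s <= m i + m j)%N) (ord_ge i j s r).
Proof.
by apply: (iffP allP) => H m; have := H m; rewrite mcoeff_msupp.
Qed.

Lemma ord_ge_sum i j s (I : Type) (l : seq I) (G : I -> S) :
  (forall x, ord_ge i j s (G x)) -> ord_ge i j s (\sum_(x <- l) G x).
Proof.
move=> H; elim/big_rec: _ => [|x r _ /ord_geP IH].
  by apply/ord_geP=> m; rewrite mcoeff0 eqxx.
apply/ord_geP=> m; rewrite mcoeffD.
have [->|/(ord_geP _ _ _ _ (H x))//] := eqVneq (G x)@_m 0.
by rewrite add0r; apply: IH.
Qed.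

Lemma ord_ge_mul i j s s' p q :
  ord_ge i j s p -> ord_ge i j s' q -> ord_ge i j (s + s') (p * q).
Proof.
move=> /allP ps /allP qs; apply/allP=> m /msuppM_le/allpairsP[[m1 m2] /= [m1p m2q ->]].
by rewrite !mnmDE; have := ps _ m1p; have := qs _ m2q; lia.
Qed.

Lemma ord_ge0 i j p : ord_ge i j 0 p.
Proof. exact/allP. Qed.

Lemma edge_monomial i j s m : i != j -> (s <= m i + m j)%N ->
  exists m' (g : 'I_s -> S), (forall l, g l = 'X_i \/ g l = 'X_j) /\
    'X_[m] = 'X_[m'] * \prod_(l < s) g l.
Proof.
move=> ij; elim: s m => [|s IH] m sm.
  by exists m, (fun=> 'X_i); split; [left | rewrite big_ord0 mulr1].
have [l [lij ml]] : exists l, (l = i \/ l = j) /\ (0 < m l)%N.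
  have [mi|] := posnP (m i); last by exists i; split; [left|].
  by exists j; split; [right | move: sm; rewrite mi; clear; lia].
have lm : (U_(l) <= m)%MM.
  by apply/mnm_lepP=> x; rewrite mnm1E; case: eqP => // <-.
have [|m' [g [gP E]]] := IH (m - U_(l))%MM.
  rewrite !mnmBE !mnm1E; case: lij sm => ->; rewrite eqxx ?(negPf ij) 1?eq_sym ?(negPf ij).
    by clear; lia.
  by clear; lia.
exists m', (fun x => if unlift ord0 x is Some y then g y else 'X_l); split.
  by move=> x; case: unliftP => [y|] _ //; case: lij => ->; [left|right].
rewrite -{1}(submK lm) mpolyXD E big_ord_recl unlift_none -mulrA [_ * 'X__]mulrC.
by congr (_ * (_ * _)); apply: eq_bigr => y _; rewrite liftK.
Qed.

(** The [t]-th power of (x_i, x_j) is spanned by the monomials of degree at least [t] in these two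
    variables, so membership is decided on exponents. *)
Lemma edge_power_ord i j r : i != j ->
  ideal_exp (edge_prime i j) t r <-> ord_ge i j t r.
Proof.
move=> ij; split=> [[s [c [g [gP ->]]]]|/allP rP].
  apply: ord_ge_sum => l; rewrite -[t]add0n; apply: ord_ge_mul; first exact: ord_ge0.
  have [h [hP ->]] := gP l; elim: (t) h hP => [|t' IH] h hP.
    by rewrite big_ord0; apply: ord_ge0.
  have h1 : ord_ge i j 1 (h ord_max).
    have [u [d [f [fP ->]]]] := hP ord_max; apply: ord_ge_sum => x.
    rewrite -[1%N]add0n; apply: ord_ge_mul; first exact: ord_ge0.
    by apply/ord_geP=> m; case: (fP x) => ->; rewrite mcoeffX;
      case: (_ =P m) => [<- _|_]; rewrite ?eqxx // !mnm1E eqxx ?addn1.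
  rewrite big_ord_recr /=; have := ord_ge_mul (IH _ (fun l => hP (widen_ord (leqnSn t') l))) h1.
  by rewrite addn1.
have gX (x : S) : x = 'X_i \/ x = 'X_j -> edge_prime i j x.
  by move=> xij; exists 1%N, (fun=> 1), (fun=> x); split; rewrite // big_ord1 mul1r.
rewrite [r]mpolyE big_seq; elim/big_rec: _ => [|m q mr IH]; first exact: gen_ideal0.
have [m' [g [gP ->]]] := edge_monomial ij (rP m mr).
rewrite -mul_mpolyC mulrA; apply: gen_idealZD IH.
exists 1%N, (fun=> 1), (fun=> \prod_(l < t) g l); split; last by rewrite big_ord1 mul1r.
by move=> _; exists g; split=> // l; apply: gX.
Qed.

Lemma cover_powerP r : reflect
  (forall m, r@_m != 0 -> forall i j, e i j -> (t <= m i + m j)%N)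
  (r \in @cover_symbolic_power k n e t).
Proof.
have ne i j : e i j -> i != j by apply: contraTneq => ->; rewrite e_irr.
apply: (iffP (asboolP _)) => H => [m rm i j eij|i j eij].
  by apply: (ord_geP i j t r _) rm; apply/edge_power_ord; [apply: ne | apply: H].
by apply/(edge_power_ord _ (ne _ _ eij))/ord_geP => m /H; apply.
Qed.

Local Notation X := (fun i : 'I_n => 'X_i : S).
Local Notation proj := (@quotmod_proj S S^o (@cover_symbolic_power k n e t)).

Lemma proj_eq0 r : proj r = 0 <-> r \in @cover_symbolic_power k n e t.
Proof.
have E0 : proj 0 = 0 by rewrite -[X in proj X](scale0r (0 : S^o)) quotmod_projZ scale0r.
by rewrite -E0 -{2}[r]subr0; split=> /quotmod_projP.
Qed.

Lemma Frac_projB f p q K :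
  Frac f (proj (p - q)) K = Frac f (proj p) K - Frac f (proj q) K.
Proof.
rewrite quotmod_projD FracD -[- q](scaleN1r (q : S^o)).
by rewrite quotmod_projZ FracZ scaleN1r.
Qed.

(** Inverting x_F turns the prime of any edge meeting [F] into the unit ideal; only edges outside
    [F] still impose a condition. *)
Lemma Frac_proj_eq0 F K r : Frac (xprod X F) (proj r) K = 0 <->
  forall m, r@_m != 0 -> forall i j, i \notin F -> j \notin F -> e i j -> (t <= m i + m j)%N.
Proof.
have E s : (xprod X F ^+ s *: proj r = 0) <->
    (r * 'X_[box F s] \in @cover_symbolic_power k n e t).
  by rewrite -quotmod_projZ proj_eq0 [_ *: _]mulrC xprod_box.
split=> [/Frac_eq0[s /E/cover_powerP H] m rm i j iF jF eij|H].
  have := H (box F s + m)%MM; rewrite mcoeffMX => /(_ rm i j eij).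
  by rewrite !mnmDE !boxE (negPf iF) (negPf jF).
(* After multiplication by x_F^t every variable of [F] has exponent at least [t], which settles all
   edges meeting [F]. *)
apply/Frac_eq0; exists t; apply/E/cover_powerP => m; rewrite mcoeffMX_if.
case: ifP => [/mnm_lepP bm rm i j eij|]; last by rewrite eqxx.
have [iF|iF] := boolP (i \in F).
  by have := bm i; rewrite boxE iF => /leq_trans; apply; apply: leq_addr.
have [jF|jF] := boolP (j \in F).
  by have := bm j; rewrite boxE jF => /leq_trans; apply; apply: leq_addl.
by have := H _ rm i j iF jF eij; rewrite !mnmBE !boxE (negPf iF) (negPf jF) !subn0.
Qed.

(* [comp r K b] collects the components of degree b - (K, ..., K) of the fractions
   r F / x_F^K. *)
Definition comp (r : {set 'I_n} -> S) K b : {ffun {set 'I_n} -> k} :=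
  [ffun F : {set 'I_n} => (r F * 'X_[box (~: F) K])@_b].

(** A negative coordinate of the degree can only come from the denominator x_F^K. *)
Lemma comp_supp rs K b F : comp rs K b F != 0 -> [set i | (b i < K)%N] \subset F.
Proof.
rewrite ffunE mcoeffMX_if; case: ifP => [/mnm_lepP bm _|]; last by rewrite eqxx.
apply/subsetP=> i; rewrite inE; apply: contraLR => iF.
by have := bm i; rewrite boxE inE iF -leqNgt.
Qed.

(** A nonzero component lies in the localized ideal exactly when the complement of [F] is
    independent in the degree graph; [2 * K] makes up for the shift by [K] at both ends of an
    edge. *)
Lemma Frac_comp_eq0 (rs : {set 'I_n} -> S) F K :
  Frac (xprod X F) (proj (rs F)) K = 0 <->
  forall b, ~~ indep (deg_graph e b (t + 2 * K)) (~: F) -> comp rs K b F = 0.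
Proof.
rewrite Frac_proj_eq0; split=> [H b /indepPn[i [j [iF jF /andP[eij bij]]]]|H m rm i j iF jF eij].
  apply/eqP; rewrite ffunE mcoeffMX_if; case: ifP => // /mnm_lepP bm.
  apply/negPn/negP=> /H/(_ i j); rewrite -!in_setC => /(_ iF jF eij).
  have := bm i; have := bm j; rewrite !mnmBE !boxE iF jF.
  by move: bij; clear; lia.
rewrite leqNgt; apply/negP=> lt_t; move/eqP: rm; apply.
rewrite -(mcoeffMX _ (box (~: F) K)); have := H (box (~: F) K + m)%MM; rewrite ffunE; apply.
apply/indepPn; exists i, j; rewrite !in_setC; split=> //; rewrite /deg_graph eij.
rewrite !mnmDE !boxE !in_setC iF jF.
by move: lt_t; clear; lia.
Qed.

(** Numerators of the Cech differential when all fractions have exponent [K]; x_j^K extends the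
    denominator at [F :\ j] to the one at [F]. *)
Definition num_diff K (rs : {set 'I_n} -> S) F : S :=
  \sum_(j in F) (-1) ^+ #|[set l in F | (l < j)%N]| *: ('X_j ^+ K * rs (F :\ j)).

(** The factor x_j^K is exactly what distinguishes the boxes of [~: (F :\ j)] and [~: F], so it
    leaves the degree unchanged. *)
Lemma comp_num_diff rs K b F : comp (num_diff K rs) K b F = diff (comp rs K b) F.
Proof.
rewrite ffunE diffE mulr_suml raddf_sum /=; apply: eq_bigr => j jF.
rewrite ffunE box_D1 // mpolyXD -mpolyXn -scalerAl -mcoeffZ.
congr mcoeff; congr (_ *: _); ring.
Qed.

Lemma cech_diff_Frac (c : cochain X (cover_quotient k e t)) rs K F :
  (forall F, c F = Frac (xprod X F) (proj (rs F)) K) ->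
  cech_diff c F = Frac (xprod X F) (proj (num_diff K rs F)) K.
Proof.
move=> cE; rewrite /cech_diff /num_diff.
rewrite (big_morph (fun r => Frac (xprod X F) (proj r) K) (id1 := 0) (op1 := +%R)).
- apply: eq_bigr => j jF; rewrite cE (loc_mapE _ _ (xprodD1 _ jF)) -quotmod_projZ -FracZ.
  rewrite -quotmod_projZ; congr Frac; congr quotmod_proj.
  by rewrite -mul_mpolyC rmorph_sign.
- by move=> p q; rewrite quotmod_projD FracD.
by rewrite (proj_eq0 0).2 ?rpred0 //; apply/Frac_eq0; exists 0%N; rewrite scaler0.
Qed.

Lemma cochain_Frac (c : cochain X (cover_quotient k e t)) :
  exists K0, forall K, (K0 <= K)%N -> exists rs : {set 'I_n} -> S,
    forall F, c F = Frac (xprod X F) (proj (rs F)) K.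
Proof.
have /choice[f fE] : forall F, exists rK : S * nat, c F = Frac (xprod X F) (proj rK.1) rK.2.
  move=> F; have [a [K ->]] := FracP (c F); have [r ->] := quotmod_surj a.
  by exists (r, K).
exists (\max_F (f F).2) => K leK; exists (fun F => xprod X F ^+ (K - (f F).2) * (f F).1) => F.
have leF : ((f F).2 <= K)%N by apply: leq_trans (leq_bigmax F) leK.
by rewrite fE -(Frac_cancel _ _ _ (K - (f F).2)) -quotmod_projZ subnK.
Qed.

End CoverPower.

(** * Nonvanishing and vanishing of local cohomology *)

Section Cohomology.
Variables (k : fieldType) (n : nat) (e : rel 'I_n) (t : nat).
Hypotheses (e_sym : ssrbool.symmetric e) (e_irr : irreflexive e).
Local Notation S := {mpoly k[n]}.
Local Notation X := (fun i : 'I_n => 'X_i : S).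
Local Notation proj := (@quotmod_proj S S^o (@cover_symbolic_power k n e t)).
Local Notation H_neq0 := (local_cohomology_neq0 X (cover_quotient k e t)).
Implicit Types (F : {set 'I_n}) (b : 'X_{1..n}) (L : seq ('I_n * 'I_n)).

Lemma box_le (b : 'X_{1..n}) F K : [set i | (b i < K)%N] \subset F ->
  (box (~: F) K <= b)%MM.
Proof.
move=> /subsetP bF; apply/mnm_lepP=> i; rewrite boxE inE; case: ifP => // iF.
by rewrite leqNgt; apply: contra iF => bi; rewrite bF // inE.
Qed.

(** The hypothesis makes the subtraction of exponents exact wherever [z] is nonzero. *)
Lemma comp_monomial (z : {ffun {set 'I_n} -> k}) K b0 b F :
  (z F != 0 -> [set i | (b0 i < K)%N] \subset F) ->
  comp (fun F => z F *: 'X_[b0 - box (~: F) K]) K b F = z F * (b0 == b)%:R.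
Proof.
move=> zF; rewrite ffunE -scalerAl mcoeffZ; have [->|/zF/box_le le_b] := eqVneq (z F) 0.
  by rewrite !mul0r.
by rewrite -mpolyXD submK // mcoeffX.
Qed.

Lemma indep_sub (h h' : rel 'I_n) (W : {set 'I_n}) : {in W &, forall x y, h x y -> h' x y} ->
  ~~ indep h W -> ~~ indep h' W.
Proof.
by move=> hh' /indepPn[x [y [xW yW hxy]]]; apply/indepPn; exists x, y; split=> //; apply: hh'.
Qed.

(** The relative cocycle of the cross-polytope is placed in a single degree; a cochain bounding it
    would bound it already in that degree. *)
Lemma cohomology_neq0 (a : 'I_n -> nat) L :
  induced_matching (deg_graph e a t) set0 L -> L != [::] ->
  (size L < n)%N /\ H_neq0 (n - (size L).+1).
Proof.
move=> L_ind L_neq0; set r := size L.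
have [z [zN dz z_bound]] :=
  cross_cocycle k (deg_graph_sym e_sym a t) (deg_graph_irr e_irr a t) L_ind L_neq0.
pose N := ~: vertices L.
have cardF F : #|~: F| = r.+1 -> #|F| = (n - r.+1)%N.
  rewrite [#|~: F|]cardsCs setCK card_ord => <-; rewrite subKn //.
  by rewrite -[X in (_ <= X)%N]card_ord max_card.
(* If [n <= r], no set has a complement of size [r.+1], and the zero chain would bound [z]. *)
have lt_n : (r < n)%N.
  rewrite ltnNge; apply/negP=> le_n; apply: (z_bound 0) => [F|F _ _ cF].
    by rewrite ffunE eqxx.
  by have := max_card (mem (~: F)); rewrite cF card_ord ltnNge le_n.
split=> //.
(* With exponent 1 in the denominators, [b0] encodes degree -1 on [N] and degree [a i] elsewhere. *)
pose b0 : 'X_{1..n} := [multinom (if i \in N then 0%N else (a i).+1) | i < n].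
have b0E i : b0 i = if i \in N then 0%N else (a i).+1 by rewrite mnmE.
have b0N K : [set i | ((b0 + box setT K)%MM i < K.+1)%N] = N.
  apply/setP=> i; rewrite inE mnmDE boxE b0E in_setT; case: (i \in N); clear; lia.
have degE K F : N \subset F -> {in ~: F &, forall x y,
    deg_graph e (b0 + box setT K)%MM (t + 2 * K.+1) x y = deg_graph e a t x y}.
  move=> /subsetP NF x y; rewrite !inE => xF yF; rewrite /deg_graph !mnmDE !boxE !b0E !in_setT.
  have -> : (x \in N) = false by apply: contraNF xF; apply: NF.
  have -> : (y \in N) = false by apply: contraNF yF; apply: NF.
  by congr (_ && _); clear; lia.
have b00 : b0 = (b0 + box setT 0)%MM by apply/mnmP=> i; rewrite mnmDE boxE if_same addn0.
have z_supp F : z F != 0 -> [set i | (b0 i < 1)%N] \subset F.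
  by rewrite b00 b0N => /zN[].
pose rs F : S := z F *: 'X_[b0 - box (~: F) 1].
have rs_comp b F : comp rs 1 b F = z F * (b0 == b)%:R by apply: comp_monomial; apply: z_supp.
pose c : cochain X (cover_quotient k e t) := fun F => Frac (xprod X F) (proj (rs F)) 1.
have cE F : c F = Frac (xprod X F) (proj (rs F)) 1 by [].
exists c; split=> [F _|[beta betaP]].
  rewrite (cech_diff_Frac F cE); apply/Frac_comp_eq0 => // b; rewrite comp_num_diff.
  have [<-|b0b] := eqVneq b0 b; last first.
    by rewrite diffE big1 // => j _; rewrite rs_comp (negPf b0b) !mulr0.
  have -> : diff (comp rs 1 b0) F = diff z F.
    by rewrite !diffE; apply: eq_bigr => j _; rewrite rs_comp eqxx mulr1.
  have [NF|NF] := boolP (N \subset F).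
    move=> nF; apply: dz; apply: indep_sub nF => x y xF yF.
    by rewrite {1}b00 (degE 0%N F NF).
  move=> _; apply/eqP; apply: contraNT NF => /diff_neq0[j _ /zN[NF _]].
  exact: subset_trans NF (subsetDl _ _).
(* The bounding cochain may need larger denominators; [b1] with exponent [K0.+1] encodes the same
   degree as [b0] with exponent 1. *)
have [K0 /(_ K0.+1 (leqnSn _))[rho rhoE]] := cochain_Frac beta.
pose b1 := (b0 + box setT K0)%MM.
have rho_supp F : comp rho K0.+1 b1 F != 0 -> N \subset F.
  by move/comp_supp; rewrite b0N.
apply: z_bound rho_supp _ => F NF nF cF.
have E : Frac (xprod X F) (proj (rs F * 'X_[box F K0] - num_diff K0.+1 rho F)) K0.+1 = 0.
  have E1 : c F = Frac (xprod X F) (proj (rs F * 'X_[box F K0])) K0.+1.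
    by rewrite cE -(Frac_cancel _ _ _ K0) -quotmod_projZ addn1 xprod_box [_ *: _]mulrC.
  have E2 : Frac (xprod X F) (proj (num_diff K0.+1 rho F)) K0.+1 = c F.
    exact: etrans (esym (cech_diff_Frac F rhoE)) (esym (betaP F (cardF F cF))).
  by rewrite Frac_projB -E1 E2 subrr.
pose res G : S := rs G * 'X_[box G K0] - num_diff K0.+1 rho G.
have nF1 : ~~ indep (deg_graph e b1 (t + 2 * K0.+1)) (~: F).
  by apply: indep_sub nF => x y xF yF; rewrite (degE K0 F NF).
have /eqP := (Frac_comp_eq0 t e_irr res F K0.+1).1 E b1 nF1.
have -> : comp res K0.+1 b1 F = z F - comp (num_diff K0.+1 rho) K0.+1 b1 F.
  rewrite [LHS]ffunE [X in _ = _ - X]ffunE mulrBl raddfB /=; congr (_ - _).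
  rewrite -mulrA -mpolyXD.
  have -> : (box F K0 + box (~: F) K0.+1 = box (~: F) 1 + box setT K0)%MM.
    apply/mnmP=> i; rewrite !mnmDE !boxE !inE.
    by case: (i \in F) => /=; clear; lia.
  rewrite mpolyXD mulrA /b1 [(b0 + _)%MM]addmC mcoeffMX.
  by have := rs_comp b0 F; rewrite ffunE eqxx mulr1.
by rewrite comp_num_diff subr_eq0 => /eqP.
Qed.

Lemma induced_matching_outside (h h' : rel 'I_n) (N : {set 'I_n}) L :
  (forall x y, x \notin N -> y \notin N -> h x y = h' x y) ->
  induced_matching h N L -> induced_matching h' set0 L.
Proof.
move=> hh' /andP[/allP LN sepL]; apply/andP; split.
  by apply/allP=> p /LN/and3P[p1 p2]; rewrite !in_set0 hh'.
apply: (sub_in_pairwise (P := [pred p | (p.1 \notin N) && (p.2 \notin N)])) sepL.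
  move=> p q /andP[p1 p2] /andP[q1 q2].
  by rewrite /sep /far !hh'.
by apply/allP=> p /LN/and3P[p1 p2 _]; rewrite inE p1 p2.
Qed.

(** In each degree the cocycle is bounded by [rel_cocycle]; the finitely many degrees that occur are
    then reassembled into one cochain. *)
Lemma cohomology_eq0 p :
  (forall a s, leafy (deg_graph e a s)) ->
  (forall a L, induced_matching (deg_graph e a t) set0 L -> size L <> (n - p.+1)%N) ->
  ~ H_neq0 p.
Proof.
move=> lf noL [c [c_cocycle c_nb]]; apply: c_nb.
have [K /(_ K (leqnn _))[rs rsE]] := cochain_Frac c.
pose N b := [set i | (b i < K)%N].
pose h b := deg_graph e b (t + 2 * K).
pose f b : {ffun {set 'I_n} -> k} :=
  [ffun F : {set 'I_n} => if #|F| == p then comp rs K b F else 0].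
have fP b F : f b F != 0 -> N b \subset F /\ #|F| = p.
  by rewrite ffunE; case: (_ =P p) => [Fp /comp_supp//|]; rewrite eqxx.
have fE b F : #|F| = p -> f b F = comp rs K b F by move=> Fp; rewrite ffunE Fp eqxx.
have /choice[g gP] : forall b, exists g : {ffun {set 'I_n} -> k},
    (forall F, g F != 0 -> N b \subset F) /\
    forall F, N b \subset F -> ~~ indep (h b) (~: F) -> f b F = diff g F.
  (* The truncated subtraction is exact outside [N b], where the two degree graphs therefore
     agree. *)
  move=> b; pose a i := (b i - K)%N.
  have hE x y : x \notin N b -> y \notin N b -> h b x y = deg_graph e a t x y.
    rewrite !inE -!leqNgt /h /deg_graph /a => bx by'; congr (_ && _).
    by move: bx by'; clear; lia.
  apply: (rel_cocycle (deg_graph_sym e_sym _ _) (deg_graph_irr e_irr _ _) _ (p := p)).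
  - exact: lf.
  - exact: fP.
  - move=> F Fp NF nF.
    have -> : diff (f b) F = diff (comp rs K b) F.
      rewrite !diffE; apply: eq_bigr => j jF; rewrite fE //.
      by move: Fp; rewrite (cardsD1 j) jF add1n => -[].
    rewrite -comp_num_diff; apply: (Frac_comp_eq0 t e_irr _ F K).1 => //.
    by rewrite -(cech_diff_Frac F rsE) c_cocycle.
  by move=> L /(induced_matching_outside hE); apply: noL.
(* The finitely many degrees with a component of [rs]; in all others both [rs] and [D] vanish. *)
pose B := undup (flatten [seq msupp (rs F * 'X_[box (~: F) K]) | F : {set 'I_n}]).
have BP b F : comp rs K b F != 0 -> b \in B.
  rewrite ffunE -mcoeff_msupp mem_undup => bF.
  by apply/flattenP; eexists; [apply: map_f; rewrite mem_enum | exact: bF].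
pose D F : S := \sum_(b <- B) g b F *: 'X_[b - box (~: F) K].
have DE b F : comp D K b F = if b \in B then g b F else 0.
  rewrite ffunE mulr_suml raddf_sum /=.
  transitivity (\sum_(b' <- B) g b' F * (b' == b)%:R).
    apply: eq_bigr => b' _; have := @comp_monomial (g b') K b' b F ((gP b').1 F).
    by rewrite ffunE.
  case: ifP => bB.
    rewrite (bigD1_seq b) ?undup_uniq //= eqxx mulr1 big1 ?addr0 // => b' /negPf ->.
    by rewrite mulr0.
  rewrite big_seq big1 // => b' b'B; case: eqP => [E|]; last by rewrite mulr0.
  by rewrite E bB in b'B.
exists (fun F => Frac (xprod X F) (proj (D F)) K) => F Fp.
rewrite (cech_diff_Frac (rs := D) (K := K)) // rsE; apply/eqP; rewrite -subr_eq0 -Frac_projB.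
apply/eqP; pose res G : S := rs G - num_diff K D G.
apply: (Frac_comp_eq0 t e_irr res F K).2 => b nF.
have -> : comp res K b F = comp rs K b F - comp (num_diff K D) K b F.
  by rewrite [LHS]ffunE [X in _ = X - _]ffunE [X in _ = _ - X]ffunE mulrBl raddfB.
rewrite comp_num_diff; have [bB|bB] := boolP (b \in B); last first.
  have -> : comp rs K b F = 0 by apply/eqP; apply: contraNT bB; apply: BP.
  by rewrite diffE big1 ?subrr // => j _; rewrite DE (negPf bB) mulr0.
have -> : diff (comp D K b) F = diff (g b) F.
  by rewrite !diffE; apply: eq_bigr => j _; rewrite DE bB.
rewrite -fE //; have [NF|NF] := boolP (N b \subset F); first by rewrite (gP b).2 ?subrr.
have -> : f b F = 0 by apply/eqP; apply: contraNT NF => /fP[].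
have -> : diff (g b) F = 0.
  apply/eqP; apply: contraNT NF => /diff_neq0[j _ /(gP b).1 NF].
  exact: subset_trans NF (subsetDl _ _).
by rewrite subrr.
Qed.

End Cohomology.

(** * Orienting matchings and determining the depth *)

Lemma subgraph_forest (n : nat) (e h : rel 'I_n) : subrel h e -> is_forest e -> is_forest h.
Proof.
move=> he forest c c2 /andP[hc uc]; apply: (forest c c2); rewrite /ucycle uc andbT.
exact: sub_cycle hc.
Qed.

(** For a proper two-colouring, all first vertices get the colour [true], hence form an independent
    set. *)
Lemma induced_matching_orient (n : nat) (h : rel 'I_n) (col : 'I_n -> bool)
    (L : seq ('I_n * 'I_n)) :
  ssrbool.symmetric h -> induced_matching h set0 L ->
  induced_matching h set0 [seq if col p.1 then p else (p.2, p.1) | p <- L].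
Proof.
move=> h_sym /andP[/allP edgeL sepL]; apply/andP; split.
  apply/allP=> _ /mapP[p /edgeL pL ->]; move: pL; case: ifP => //= _.
  by rewrite !in_set0 h_sym.
rewrite pairwise_map; apply: sub_pairwise sepL => p q.
by rewrite /sep /=; case: (col p.1); case: (col q.1) => /and4P[f1 f2 f3 f4] /=;
  rewrite f1 f2 f3 f4.
Qed.

Theorem theorem1p3 (k : fieldType) (n : nat) (e : rel 'I_n)
    (n_gt0 : (0 < n)%N)
    (e_sym : ssrbool.symmetric e) (e_irr : irreflexive e)
    (no_isolated : forall i, exists j, e i j)
    (t : nat) (t_ge1 : (1 <= t)%N) :
  exists d : nat,
    [/\ is_depth (fun i : 'I_n => 'X_i : {mpoly k[n]}) (cover_quotient k e t) d,
        d%:Z <= n%:Z - 1 - (alpha e t)%:Z &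
        is_forest e -> d%:Z = n%:Z - 1 - (alpha e t)%:Z].
Proof.
(* A single edge, with all degrees 0, is enough; [cohomology_neq0] requires a nonempty matching. *)
have alpha_gt0 : (0 < alpha e t)%N.
  have [j eij] := no_isolated (Ordinal n_gt0).
  apply: (@induced_matching_alpha _ _ e_sym e_irr (fun=> 0%N) t [:: (Ordinal n_gt0, j)]) => //.
    by rewrite /induced_matching /= !in_set0 /deg_graph eij t_ge1.
  by move=> p q; rewrite !inE => /eqP-> /eqP->; rewrite e_irr.
have [a [L [L_ind L_size]]] : exists a L,
    induced_matching (deg_graph e a t) set0 L /\ size L = alpha e t.
  pose P : pred {set {set 'I_n}} :=
    fun M => `[< is_ordered_matching e M /\ ell_le e M (2 * t - 1) >].
  have alphaE : alpha e t = \max_(M in P) #|M| by apply: eq_bigl.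
  have P_gt0 : (0 < #|P|)%N.
    rewrite lt0n; apply: contraTneq alpha_gt0 => P0.
    by rewrite alphaE big_pred0 //; apply: card0_eq.
  have [M /asboolP[ordM ellM] ME] := eq_bigmax_cond (fun M : {set {set 'I_n}} => #|M|) P_gt0.
  by rewrite alphaE ME; apply: ordered_matching_induced ellM.
have L_neq0 : L != [::] by rewrite -size_eq0 L_size -lt0n.
have [lt_n Hn] := cohomology_neq0 k e_sym e_irr L_ind L_neq0.
rewrite L_size in lt_n Hn.
(* The depth is the least degree with nonzero cohomology; [Hn] shows that there is one. *)
pose P d := `[< local_cohomology_neq0 (fun i : 'I_n => 'X_i : {mpoly k[n]})
  (cover_quotient k e t) d >].
have exP : exists d, P d by exists (n - (alpha e t).+1)%N; apply/asboolP.
case: (ex_minnP exP) => d /asboolP Hd min_d.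
have le_d : (d <= n - (alpha e t).+1)%N by apply: min_d; apply/asboolP.
exists d; split.
- split=> // p lt_pd Hp; have /min_d : P p by apply/asboolP.
  by rewrite leqNgt lt_pd.
- by move: le_d lt_n; clear; lia.
move=> forest; suff : (n - (alpha e t).+1 <= d)%N by move: le_d lt_n; clear; lia.
rewrite leqNgt; apply/negP=> lt_d.
have leafy_deg b s : leafy (deg_graph e b s).
  apply: forest_leafy; [exact: deg_graph_sym | exact: deg_graph_irr |].
  by apply: subgraph_forest forest => x y /andP[].
have [col colP] : exists col : 'I_n -> bool, forall x y, e x y -> col x != col y.
  by apply: leafy_bipartite => //; apply: forest_leafy.
(* Nonzero cohomology in degree [d] needs an induced matching with [n - d.+1] edges, more than
   [alpha e t]; oriented along the bipartition, it contradicts [induced_matching_alpha]. *)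
apply: (cohomology_eq0 e_sym e_irr leafy_deg _ Hd) => b L' L'_ind L'_size.
have := induced_matching_orient col (deg_graph_sym e_sym b t) L'_ind.
move/(induced_matching_alpha e_sym e_irr t_ge1); rewrite size_map L'_size.
have -> : (n - d.+1 <= alpha e t)%N = false by move: lt_d; clear; lia.
move=> H; suff: false by []; apply: H => _ _ /mapP[p pL ->] /mapP[q qL ->].
have colL r : r \in L' -> col (if col r.1 then r else (r.2, r.1)).1.
  have /andP[/allP edgeL' _] := L'_ind.
  move=> /edgeL'/and3P[_ _ /andP[/colP]]; case: ifP => //=.
  by case: (col r.2).
by apply/negP=> /colP; rewrite !colL.
Qed.
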